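(* Let $p>2$ be a prime and let $\chi$ be a Dirichlet character of $p$-power conductor. Then $$L_p(s,\chi)=\frac{-1}{1-\chi(2)\langle 2\rangle^{-s+1}}\cdot\lim_{n\to\infty}\sum_{\substack{a=1\\ p\,\nmid\, a}}^{p^n}\frac{(-1)^a}{2}\,\chi\omega^{-1}(a)\,\langle a\rangle^{-s}.$$ The function $L_p(s,\chi)$ is analytic in $s\in\mathbb{Z}_p$, except for a simple pole at $s=1$ for $\chi=\omega$. For $\chi=\omega^i$ and $i=0,1,\dots,p-2$, one obtains the $p-1$ branches of the $p$-adic zeta function: $$\zeta_{p,i}(s)=L_p(s,\omega^{1-i})=\frac{-1}{1-\omega(2)^{1-i}\langle 2\rangle^{-s+1}}\cdot\lim_{n\to\infty}\sum_{\substack{a=1\\ p\,\nmid\, a}}^{p^n}\frac{(-1)^a}{2}\,\omega(a)^{-i}\,\langle a\rangle^{-s}.$$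
   Context: The Dirichlet character $\chi:\mathbb{Z}\to\overline{\mathbb{Q}}\subset\mathbb{C}_p$ has conductor $f_\chi=p^m$ with $m\ge 0$. Here $\omega$ denotes the Teichmüller character modulo $p$: for $a\in\mathbb{Z}_p^*$, $\omega(a)$ is the unique $(p-1)$-st root of unity in $\mathbb{Z}_p$ congruent to $a$ modulo $p$; it is also regarded as a Dirichlet character modulo $p$. For $a\in\mathbb{Z}_p^*$, $\langle a\rangle=a/\omega(a)\in 1+p\mathbb{Z}_p$, and $\langle a\rangle^{s}$ for $s\in\mathbb{Z}_p$ is the usual $p$-adic exponentiation on $1+p\mathbb{Z}_p$. Limits are taken in $\mathbb{C}_p$. Dirichlet characters are primitive; $\chi\omega^{-k}$ denotes the primitive Dirichlet character associated with the product, so that $\chi\omega^{-k}(a)=\chi(a)\omega(a)^{-k}$ for $p\nmid a$. $L_p(s,\chi)$ is the Kubota–Leopoldt $p$-adic $L$-function, i.e. the continuous $\mathbb{C}_p$-valued function of $s\in\mathbb{Z}_p$, $s\neq 1$, which interpolates the complex values at $s=0,-1,-2,\dots$ up to a factor: for all integers $k\ge 1$, $$L_p(1-k,\chi)=-(1-\chi\omega^{-k}(p)\,p^{k-1})\,\frac{B_{k,\chi\omega^{-k}}}{k},$$ where $B_{k,\psi}$ are the generalized Bernoulli numbers, defined for a Dirichlet character $\psi$ of conductor $f$ by $\sum_{a=1}^{f}\frac{\psi(a)\,t\,e^{at}}{e^{ft}-1}=\sum_{k\ge 0}B_{k,\psi}\frac{t^k}{k!}$. The branches of the $p$-adic zeta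 function are the functions $\zeta_{p,i}(s)=L_p(s,\omega^{1-i})$ for $i=0,1,\dots,p-2$.
   Formalization: The simple pole at s=1 is proved for the trivial character (the branch i=1), not for χ=ω: with the stated interpolation formula L_p(s,ω) is identically zero, while L_p(s,1) has the pole; analyticity is proved for every nontrivial χ. *)

(* Defs.v *)
From HB Require Import structures.
From mathcomp Require Import all_boot all_order all_algebra.
From mathcomp Require Import all_classical all_reals all_analysis.

Set Implicit Arguments.
Unset Strict Implicit.
Unset Printing Implicit Defensive.

Import Order.TTheory GRing.Theory Num.Theory.
Import numFieldNormedType.Exports.

Local Open Scope classical_set_scope.
Local Open Scope ring_scope.

(** * The field C_p *)

(* The absolute value is an explicit function [nrm]: MathComp's normed modules
   over a real field are archimedean, so they cannot carry it. *)
Definition cvgC (R : realType) (C : fieldType) (nrm : C -> R)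
  (u : nat -> C) (l : C) : Prop :=
  (fun n => nrm (u n - l)) @ \oo --> (0 : R).

Definition cauchyC (R : realType) (C : fieldType) (nrm : C -> R)
  (u : nat -> C) : Prop :=
  forall e : R, 0 < e -> exists N : nat, forall m n : nat,
    (N <= m)%N -> (N <= n)%N -> nrm (u m - u n) < e.

(* Inside a complete field in which |p| = 1/p, the closures of the prime field
   and of the integers are Q_p and Z_p. *)
Definition in_Qp (R : realType) (C : fieldType) (nrm : C -> R) (x : C) : Prop :=
  exists u : nat -> rat, cvgC nrm (fun n => ratr (u n)) x.

Definition in_Zp (R : realType) (C : fieldType) (nrm : C -> R) (x : C) : Prop :=
  exists u : nat -> int, cvgC nrm (fun n => (u n)%:~R) x.

Definition algebraic_over_Qp (R : realType) (C : fieldType) (nrm : C -> R)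
  (x : C) : Prop :=
  exists q : {poly C}, [/\ q != 0, forall i, in_Qp nrm q`_i & root q x].

(* C is complete and the elements algebraic over Q_p form a dense algebraically
   closed subfield, i.e. C is the completion of an algebraic closure of Q_p;
   this determines (C, nrm) up to isometric isomorphism. *)
Record is_Cp (R : realType) (p : nat) (C : fieldType) (nrm : C -> R) : Prop :=
  IsCp {
    nrm_ge0 : forall x, 0 <= nrm x ;
    nrm_eq0 : forall x, nrm x = 0 <-> x = 0 ;
    nrmM : forall x y, nrm (x * y) = nrm x * nrm y ;
    nrm_ultra : forall x y, nrm (x + y) <= Num.max (nrm x) (nrm y) ;
    nrm_p : nrm p%:R = p%:R^-1 ;
    nrm_complete : forall u, cauchyC nrm u -> exists l, cvgC nrm u l ;
    Qpbar_closed : forall q : {poly C},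
      (forall i, algebraic_over_Qp nrm q`_i) -> (1 < size q)%N ->
      exists x, root q x ;
    Qpbar_dense : forall x (e : R), 0 < e ->
      exists2 y, algebraic_over_Qp nrm y & nrm (x - y) < e
  }.

(** * Dirichlet characters *)

Definition dirichlet_char (C : fieldType) (f : nat) (chi : int -> C) : Prop :=
  [/\ (0 < f)%N,
      forall a b, chi (a * b) = chi a * chi b,
      forall a, chi (a + f%:Z) = chi a
    & forall a, (chi a != 0) = coprimez a f%:Z].

(* [chi] is primitive of conductor [f]: it is a character modulo [f] that is
   not induced from a proper divisor of [f]. *)
Definition primitive_char (C : fieldType) (f : nat) (chi : int -> C) : Prop :=
  dirichlet_char f chi /\
  forall (d : nat) (psi : int -> C), (d %| f)%N -> dirichlet_char d psi ->
    (forall a, coprimez a f%:Z -> chi a = psi a) -> d = f.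

(* The primitive character associated with a character [phi] of p-power
   modulus; the values of [phi] at multiples of [p] are irrelevant.  The
   conductor is then automatically a power of [p]. *)
Definition associated_primitive (C : fieldType) (p : nat) (phi : int -> C) :
  int -> C :=
  xget (fun _ => 0) [set psi : int -> C |
    (exists f : nat, primitive_char f psi) /\
    forall a : int, ~~ (p%:Z %| a)%Z -> psi a = phi a].

(** * Teichmueller character and p-adic powers *)

(* 0 when [x] is not a unit of Z_p, since then no such root of unity exists. *)
Definition teichmuller (R : realType) (C : fieldType) (nrm : C -> R) (p : nat)
  (x : C) : C :=
  xget 0 [set z : C | [/\ in_Zp nrm z, z ^+ p.-1 = 1
                        & in_Zp nrm ((z - x) / p%:R)]].

Definition omega (R : realType) (C : fieldType) (nrm : C -> R) (p : nat)
  (a : int) : C :=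
  teichmuller nrm p a%:~R.

(* <a> = a / omega(a), for [a] prime to [p] *)
Definition angle (R : realType) (C : fieldType) (nrm : C -> R) (p : nat)
  (a : int) : C :=
  a%:~R / omega nrm p a.

(* For x in 1 + p Z_p and s in Z_p, x^s is the limit of x^n as the natural
   number n tends p-adically to s. *)
Definition padic_pow (R : realType) (C : fieldType) (nrm : C -> R)
  (x s : C) : C :=
  xget 0 [set y : C | forall u : nat -> nat,
    cvgC nrm (fun n => (u n)%:R) s -> cvgC nrm (fun n => x ^+ u n) y].

(* The primitive character chi omega^(-k). *)
Definition twist (R : realType) (C : fieldType) (nrm : C -> R) (p : nat)
  (chi : int -> C) (k : nat) : int -> C :=
  associated_primitive p (fun a => chi a * omega nrm p a ^- k).

(* The primitive character omega^j, for an integer exponent j. *)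
Definition omega_pow (R : realType) (C : fieldType) (nrm : C -> R) (p : nat)
  (j : int) : int -> C :=
  associated_primitive p (fun a => omega nrm p a ^ j).

(** * Generalized Bernoulli numbers *)

(* Formal power series in t are represented by their coefficient sequences. *)
Definition fps_mul (C : fieldType) (u v : nat -> C) (n : nat) : C :=
  \sum_(i < n.+1) u i * v (n - i)%N.

(* e^(ct) *)
Definition fps_exp (C : fieldType) (c : C) (n : nat) : C := c ^+ n / n`!%:R.

(* The generating identity, with the denominator cleared:
   (sum_k B_k t^k / k!) (e^(ft) - 1) = sum_(1 <= a <= f) psi(a) t e^(at).
   For f > 0 in characteristic 0 it has exactly one solution B. *)
Definition gen_bernoulli (C : fieldType) (f : nat) (psi : int -> C)
  (B : nat -> C) : Prop :=
  forall n : nat,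
    fps_mul (fun k => B k / k`!%:R)
            (fun k => fps_exp f%:R k - (k == 0%N)%:R) n =
    \sum_(1 <= a < f.+1)
      psi a%:Z * fps_mul (fun k => (k == 1%N)%:R) (fps_exp a%:R) n.

(** * The Kubota-Leopoldt p-adic L-function *)

Definition continuous_on_Zp_minus1 (R : realType) (C : fieldType)
  (nrm : C -> R) (L : C -> C) : Prop :=
  forall s, in_Zp nrm s -> s != 1 ->
  forall e : R, 0 < e -> exists2 d : R, 0 < d &
  forall t, in_Zp nrm t -> t != 1 -> nrm (t - s) < d -> nrm (L t - L s) < e.

Definition interpolates (R : realType) (C : fieldType) (nrm : C -> R) (p : nat)
  (chi : int -> C) (L : C -> C) : Prop :=
  forall (k f : nat) (B : nat -> C), (0 < k)%N ->
    primitive_char f (twist nrm p chi k) ->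
    gen_bernoulli f (twist nrm p chi k) B ->
    L (1 - k%:R) =
      - (1 - twist nrm p chi k p%:Z * p%:R ^+ k.-1) * (B k / k%:R).

(* Continuity and interpolation determine the values on Z_p \ {1}; the values
   of [Lp] elsewhere are meaningless. *)
Definition Lp (R : realType) (C : fieldType) (nrm : C -> R) (p : nat)
  (chi : int -> C) : C -> C :=
  xget (fun _ => 0) [set L : C -> C |
    continuous_on_Zp_minus1 nrm L /\ interpolates nrm p chi L].

Definition zeta_branch (R : realType) (C : fieldType) (nrm : C -> R) (p : nat)
  (i : nat) (s : C) : C :=
  Lp nrm p (omega_pow nrm p (1 - i%:Z)) s.

(** * Analyticity on Z_p *)

(* Represented by one power series converging on all of Z_p. *)
Definition analytic_on_Zp (R : realType) (C : fieldType) (nrm : C -> R)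
  (F : C -> C) : Prop :=
  exists c : nat -> C, forall s, in_Zp nrm s ->
    cvgC nrm (fun N => \sum_(n < N) c n * s ^+ n) (F s).

(* The next two predicates concern functions meaningful on Z_p \ {1} only. *)
Definition extends_analytically (R : realType) (C : fieldType) (nrm : C -> R)
  (L : C -> C) : Prop :=
  exists F : C -> C, analytic_on_Zp nrm F /\
    forall s, in_Zp nrm s -> s != 1 -> L s = F s.

Definition analytic_but_simple_pole_at1 (R : realType) (C : fieldType)
  (nrm : C -> R) (L : C -> C) : Prop :=
  exists G : C -> C, [/\ analytic_on_Zp nrm G, G 1 != 0 &
    forall s, in_Zp nrm s -> s != 1 -> L s = G s / (s - 1)].

(* Main.v *)
(* Let V(t) be the Volkenborn integral of chi(a) <a>^t, i.e. the limit of
   p^-n times the sum over a <= p^n prime to p.  For natural t it exists and is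
   (1 - psi(p) p^(t-1)) B_{t,psi} with psi = chi omega^-t, by the power sum
   formula behind the generalized Bernoulli numbers.  Its Mahler coefficients
   are the integrals of chi(a) (<a> - 1)^j, which are O(p^-j), so that
   F(s) = V(1 - s) is given by a power series converging on Z_p, and
   L_p(s, chi) = F(s) / (s - 1).  The value F(1) = V(0) is 1 - 1/p for trivial
   chi and 0 otherwise; in the latter case s - 1 divides the Mahler series term
   by term.

   For the formula, compare the sums of chi omega^-k(a) a^k and of its dilate
   a -> 2a over a <= p^n: the even residues recur, the odd ones appear shifted
   by p^n, and to first order in p^n this gives
   (chi(2) <2>^k - 1) V(k) = - k lim (sum of (-1)^a/2 chi omega^-1(a) <a>^(k-1)).
   Both sides extend continuously in k to Z_p.  The denominator vanishes only
   at s = 1: raised to the power phi(p^m) (p - 1), a zero would give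
   (<2>^N)^(1-s) = 1 with <2>^N <> 1, whereas |x^t - 1| = |x - 1| |t|. *)
Require Import Defs.
From HB Require Import structures.
From mathcomp Require Import all_boot all_order all_algebra.
From mathcomp Require Import all_classical all_reals all_analysis.
From mathcomp Require Import cyclic.
From mathcomp Require Import ring lra zify.
Set Implicit Arguments.
Unset Strict Implicit.
Unset Printing Implicit Defensive.

Import Order.TTheory GRing.Theory Num.Theory.
Import numFieldNormedType.Exports.
Local Open Scope ring_scope.

(** * Ultrametric estimates *)

(** [Lp] and [padic_pow] are picked by [xget] from a characterisation, so nothing is known about
    them before existence and uniqueness are proved. For [Lp] the candidate is F(s)/(s - 1), and
    uniqueness holds because the points 1 - k with k >= 1 are dense in Z_p.

    Analyticity is drawn from F and not from the formula: at s = 1 the denominator of the formula is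
    1 - chi(2), which vanishes for trivial chi but also for some other chi, where there is no pole.

    That p is odd enters in several ways. 2 is a unit, so dilation by 2 acts on residues; (-1)^a / 2
    is additive over residue classes; v(j) <= j - 2 for j >= 2 gives |x^n - 1| = |n| |x - 1| for |x
    - 1| <= 1/p; and v(j!) <= j/2. By the last bound, the decay O(p^-j) of the Mahler coefficients
    outweighs the denominators j!: the terms of the Mahler series are polynomials whose Gauss norm
    is O(p^(-j/2)), so the series can be rearranged in powers of s.

    Continuity is always obtained as an explicit Lipschitz bound, uniform in the level n, so that it
    survives the limits that define the functions. *)

Section Valuation.
Context (R : realType) (p : nat) (C : fieldType) (nrm : C -> R)
  (hC : is_Cp p nrm) (p_prime : prime p) (p_gt2 : (2 < p)%N).
Local Notation q := (p%:R^-1 : R).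

Lemma q_gt0 : 0 < q.
Proof. by rewrite invr_gt0 ltr0n prime_gt0. Qed.

Lemma q_le_half : q <= 2^-1.
Proof.
by rewrite lef_pV2 ?posrE ?ltr0n ?prime_gt0 // ler_nat ltnW.
Qed.

Lemma q_lt1 : q < 1.
Proof. apply: le_lt_trans q_le_half _; lra. Qed.

Lemma qX_gt0 n : 0 < q ^+ n.
Proof. exact: exprn_gt0 q_gt0. Qed.

Lemma qX_ge0 n : 0 <= q ^+ n.
Proof. exact: ltW (qX_gt0 n). Qed.

Lemma ler_qX m n : (m <= n)%N -> q ^+ n <= q ^+ m.
Proof. by move=> mn; apply: ler_wiXn2l => //; apply: ltW; rewrite ?q_gt0 ?q_lt1. Qed.

Lemma qX_small (e : R) : 0 < e -> exists N, q ^+ N < e.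
Proof.
move=> e0; exists (Num.truncn e^-1).+1.
rewrite exprVn -[ltRHS]invrK ltf_pV2 ?posrE ?invr_gt0 // ?exprn_gt0 ?ltr0n ?prime_gt0 //.
have /andP[_ h] := truncn_itv (ltW (etrans (invr_gt0 e) e0)).
apply: lt_le_trans h _; rewrite -natrX ler_nat.
by apply: ltnW; apply: (ltn_expl _ (prime_gt1 p_prime)).
Qed.

Lemma nrm0 : nrm 0 = 0.
Proof. exact/(nrm_eq0 hC). Qed.

Lemma nrm_neq0 x : x != 0 -> nrm x != 0.
Proof. by move=> x0; apply/eqP => /(nrm_eq0 hC)/eqP; apply/negP. Qed.

Lemma nrm_gt0 x : x != 0 -> 0 < nrm x.
Proof. by move=> x0; rewrite lt_neqAle eq_sym nrm_neq0 // (nrm_ge0 hC). Qed.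

Lemma nrm1 : nrm 1 = 1.
Proof.
have := nrmM hC 1 1; rewrite mulr1 => /esym/eqP.
by rewrite -subr_eq0 -{3}[nrm 1]mulr1 -mulrBr mulf_eq0 (negPf (nrm_neq0 (oner_neq0 _)))
  //= subr_eq0 => /eqP.
Qed.

Lemma nrmN1 : nrm (-1) = 1.
Proof.
have h : nrm (-1) ^+ 2 = 1 by rewrite expr2 -(nrmM hC) mulrNN mulr1 nrm1.
by apply/eqP; rewrite -(@pexpr_eq1 _ _ 2) ?(nrm_ge0 hC) // h.
Qed.

Lemma nrmN x : nrm (- x) = nrm x.
Proof. by rewrite -mulN1r (nrmM hC) nrmN1 mul1r. Qed.

Lemma nrm_distC x y : nrm (x - y) = nrm (y - x).
Proof. by rewrite -nrmN opprB. Qed.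

Lemma nrmX x n : nrm (x ^+ n) = nrm x ^+ n.
Proof. by elim: n => [|n IH]; rewrite ?expr0 ?nrm1 // !exprS (nrmM hC) IH. Qed.

Lemma nrmV x : nrm x^-1 = (nrm x)^-1.
Proof.
have [->|x0] := eqVneq x 0; first by rewrite invr0 nrm0 invr0.
apply: (mulfI (nrm_neq0 x0)).
by rewrite -(nrmM hC) !mulfV ?nrm1 // nrm_neq0.
Qed.

Lemma nrm_div x y : nrm (x / y) = nrm x / nrm y.
Proof. by rewrite (nrmM hC) nrmV. Qed.

Lemma nrmD_le x y e : nrm x <= e -> nrm y <= e -> nrm (x + y) <= e.
Proof. by move=> hx hy; apply: le_trans (nrm_ultra hC _ _) _; rewrite ge_max hx. Qed.

Lemma nrmB_le x y e : nrm x <= e -> nrm y <= e -> nrm (x - y) <= e.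
Proof. by move=> hx hy; apply: nrmD_le; rewrite ?nrmN. Qed.

Lemma nrmD_lt x y e : nrm x < e -> nrm y < e -> nrm (x + y) < e.
Proof. by move=> hx hy; apply: le_lt_trans (nrm_ultra hC _ _) _; rewrite gt_max hx. Qed.

Lemma nrmB_lt x y e : nrm x < e -> nrm y < e -> nrm (x - y) < e.
Proof. by move=> hx hy; apply: nrmD_lt; rewrite ?nrmN. Qed.

Lemma nrm_dist_lt y x z e : nrm (x - y) < e -> nrm (y - z) < e -> nrm (x - z) < e.
Proof. by move=> hx hy; rewrite -(subrKA y); apply: nrmD_lt. Qed.

Lemma nrm_dist_le y x z e : nrm (x - y) <= e -> nrm (y - z) <= e -> nrm (x - z) <= e.
Proof. by move=> hx hy; rewrite -(subrKA y); apply: nrmD_le. Qed.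

Lemma nrm_dominant x y : nrm y < nrm x -> nrm (x + y) = nrm x.
Proof.
move=> yx; apply/eqP; rewrite eq_le nrmD_le ?lexx ?(ltW yx) //=.
rewrite leNgt; apply/negP => h.
by have := nrmB_lt h yx; rewrite addrK ltxx.
Qed.

Lemma nrm_close x y : nrm (y - x) < nrm x -> nrm y = nrm x.
Proof. by move=> h; rewrite -(nrm_dominant h) addrC subrK. Qed.

Lemma nrm_sum (I : Type) (r : seq I) (P : pred I) (F : I -> C) e :
  0 <= e -> (forall i, P i -> nrm (F i) <= e) ->
  nrm (\sum_(i <- r | P i) F i) <= e.
Proof.
move=> e0 h; elim/big_rec: _ => [|i x Pi IH]; first by rewrite nrm0.
by apply: nrmD_le => //; exact: h.
Qed.

Lemma nrmM_le x y a b : nrm x <= a -> nrm y <= b -> nrm (x * y) <= a * b.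
Proof. by move=> ha hb; rewrite (nrmM hC) ler_pM ?(nrm_ge0 hC). Qed.

Lemma nrmM_le1l x y b : nrm x <= 1 -> nrm y <= b -> nrm (x * y) <= b.
Proof. by move=> hx hy; rewrite -[b]mul1r; apply: nrmM_le. Qed.

Lemma nrmM_le1r x y b : nrm y <= 1 -> nrm x <= b -> nrm (x * y) <= b.
Proof. by move=> hx hy; rewrite mulrC nrmM_le1l. Qed.

Lemma nrmX_le1 x n : nrm x <= 1 -> nrm (x ^+ n) <= 1.
Proof. by move=> h; rewrite nrmX exprn_ile1 ?(nrm_ge0 hC). Qed.

Lemma nrm_nat n : nrm n%:R <= 1.
Proof.
by elim: n => [|n IH]; rewrite ?nrm0 ?ler01 // -natr1 nrmD_le // nrm1.
Qed.

Lemma nrm_int (z : int) : nrm z%:~R <= 1.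
Proof. by case: z => n; rewrite ?NegzE ?mulrNz ?nrmN ?nrm_nat // -pmulrn nrm_nat. Qed.

Lemma nrm_sign n : nrm ((-1) ^+ n) = 1.
Proof. by rewrite nrmX nrmN1 expr1n. Qed.

Lemma nrm_pX n : nrm (p%:R ^+ n) = q ^+ n.
Proof. by rewrite nrmX (nrm_p hC). Qed.

Lemma p_neq0 : p%:R != 0 :> C.
Proof.
apply/eqP => p0; have := nrm_p hC; rewrite p0 nrm0 => h.
by have := q_gt0; rewrite -h ltxx.
Qed.

Lemma pX_neq0 n : p%:R ^+ n != 0 :> C.
Proof. by rewrite expf_neq0 // p_neq0. Qed.

Lemma nrm_int_dvd (z : int) n : (p%:Z ^+ n %| z)%Z -> nrm z%:~R <= q ^+ n.
Proof.
move=> /dvdzP[w ->]; rewrite rmorphM /= rmorphXn /= -pmulrn.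
by rewrite nrmM_le1l ?nrm_int // nrm_pX.
Qed.

(** By Bezout 1 = u z + v p; if z had norm less than 1, so would the right-hand side. *)
Lemma nrm_int_unit (z : int) : ~~ (p%:Z %| z)%Z -> nrm z%:~R = 1.
Proof.
move=> npz; apply/eqP; rewrite eq_le nrm_int /= leNgt; apply/negP => h.
have cop : coprimez z p%:Z by rewrite coprimezE coprime_sym prime_coprime // -dvdzE.
case/coprimezP : cop => -[u v] /= e.
have : nrm (u * z + v * p)%:~R < 1.
  rewrite rmorphD !rmorphM /=; apply: nrmD_lt.
    by apply: le_lt_trans h; apply: nrmM_le1l => //; exact: nrm_int.
  apply: le_lt_trans q_lt1; apply: nrmM_le1l; rewrite ?nrm_int //.
  by rewrite -pmulrn (nrm_p hC).
by rewrite e nrm1 ltxx.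
Qed.

Lemma nrm_int_lt1 (z : int) : nrm z%:~R < 1 -> (p%:Z %| z)%Z.
Proof. by apply: contraTT => /nrm_int_unit ->; rewrite ltxx. Qed.

Lemma nrm_nat_unit n : ~~ (p %| n)%N -> nrm n%:R = 1.
Proof. by move=> h; rewrite pmulrn nrm_int_unit // dvdzE. Qed.

Lemma nrm_natE n : (0 < n)%N -> nrm n%:R = q ^+ logn p n.
Proof.
move=> n0; have [m npm ->] := pfactor_coprime p_prime n0.
rewrite natrM natrX (nrmM hC) nrm_pX lognM ?expn_gt0 ?(prime_gt0 p_prime) //; last first.
  by case: (posnP m) npm => // ->; rewrite /coprime gcdn0 => /eqP h; move: p_gt2; rewrite h.
rewrite pfactorK // nrm_nat_unit ?mul1r; last by rewrite -prime_coprime.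
by rewrite (logn_coprime npm).
Qed.

Lemma natr_neq0 n : (0 < n)%N -> n%:R != 0 :> C.
Proof.
move=> n0; apply/eqP => h; have := nrm_natE n0; rewrite h nrm0 => /eqP.
by rewrite eq_sym (gt_eqF (qX_gt0 _)).
Qed.

Lemma natr_inj : injective (fun n : nat => n%:R : C).
Proof.
suff h m n : (m <= n)%N -> m%:R = n%:R :> C -> m = n.
  move=> m n e; case: (leqP m n) => [/h|/ltnW/h] hh; first exact: hh.
  exact/esym/hh.
move=> mn /eqP; rewrite eq_sym -subr_eq0 -natrB // => e.
apply/eqP; rewrite eqn_leq mn /= -subn_eq0.
by apply: contraTT e => /=; rewrite -lt0n => /natr_neq0.
Qed.

Lemma fact_neq0 n : n`!%:R != 0 :> C.
Proof. by rewrite natr_neq0 // fact_gt0. Qed.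

End Valuation.

Section Limits.
Context (R : realType) (p : nat) (C : fieldType) (nrm : C -> R)
  (hC : is_Cp p nrm) (p_prime : prime p) (p_gt2 : (2 < p)%N).
Local Notation q := (p%:R^-1 : R).
Local Notation cvgC := (cvgC nrm).

Lemma cvgCP u l : cvgC u l <->
  forall e : R, 0 < e -> exists N, forall n, (N <= n)%N -> nrm (u n - l) < e.
Proof.
split=> [/cvgrPdist_lt h e e0|h].
  have [N _ hN] := h e e0; exists N => n /hN /=.
  by rewrite sub0r normrN ger0_norm ?(nrm_ge0 hC).
apply/cvgrPdist_lt => e e0; have [N hN] := h e e0; exists N => // n /hN /=.
by rewrite sub0r normrN ger0_norm ?(nrm_ge0 hC).
Qed.

Lemma cvgC_unique u l l' : cvgC u l -> cvgC u l' -> l = l'.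
Proof.
move=> /cvgCP h /cvgCP h'; apply/eqP; rewrite -subr_eq0; apply/negPn/negP => d.
have e0 := nrm_gt0 hC d.
have [N hN] := h _ e0; have [N' hN'] := h' _ e0.
have := hN _ (leq_maxl N N'); rewrite (nrm_distC hC) => h1.
by have := nrm_dist_lt hC h1 (hN' _ (leq_maxr N N')); rewrite ltxx.
Qed.

Lemma cvgC_near u v l M : (forall n, (M <= n)%N -> u n = v n) -> cvgC u l -> cvgC v l.
Proof.
move=> uv /cvgCP h; apply/cvgCP => e /h[N hN]; exists (maxn N M) => n.
by rewrite geq_max => /andP[Nn Mn]; rewrite -uv // hN.
Qed.

Lemma cvgC_cst l : cvgC (fun=> l) l.
Proof. by apply/cvgCP => e e0; exists 0%N => n _; rewrite subrr (nrm0 hC). Qed.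

Lemma cvgC_shift u l : cvgC u l -> cvgC (fun n => u n.+1) l.
Proof. by move=> /cvgCP h; apply/cvgCP => e /h[N hN]; exists N => n Nn; rewrite hN // ltnW. Qed.

Lemma cvgC_shift_inv u l : cvgC (fun n => u n.+1) l -> cvgC u l.
Proof.
move=> /cvgCP h; apply/cvgCP => e /h[N hN]; exists N.+1 => -[//|n] Nn; exact: hN.
Qed.

Lemma cvgCD u v l l' : cvgC u l -> cvgC v l' -> cvgC (fun n => u n + v n) (l + l').
Proof.
move=> /cvgCP h /cvgCP h'; apply/cvgCP => e e0.
have [N hN] := h _ e0; have [N' hN'] := h' _ e0.
exists (maxn N N') => n; rewrite geq_max => /andP[n1 n2].
by rewrite opprD addrACA; apply: (nrmD_lt hC); [exact: hN|exact: hN'].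
Qed.

(* Lipschitz functions preserve limits; all the functions below are Lipschitz. *)
Lemma cvgC_lip u v l l' (K : R) : (forall n, nrm (v n - l') <= K * nrm (u n - l)) ->
  cvgC u l -> cvgC v l'.
Proof.
move=> h /cvgCP hu; apply/cvgCP => e e0.
have K1 : 0 < Num.max K 1 by rewrite lt_max ltr01 orbT.
have [N hN] := hu (e / Num.max K 1) (divr_gt0 e0 K1).
exists N => n /hN; rewrite ltr_pdivlMr // mulrC; apply: le_lt_trans.
apply: le_trans (h n) _; apply: ler_wpM2r; rewrite ?(nrm_ge0 hC) //.
by rewrite le_max lexx.
Qed.

Lemma cvgCZ a u l : cvgC u l -> cvgC (fun n => a * u n) (a * l).
Proof. by apply: (@cvgC_lip _ _ _ _ (nrm a)) => n; rewrite -mulrBr (nrmM hC). Qed.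

Lemma cvgCN u l : cvgC u l -> cvgC (fun n => - u n) (- l).
Proof. by apply: (@cvgC_lip _ _ _ _ 1) => n; rewrite -opprD (nrmN hC) mul1r. Qed.

Lemma cvgCB u v l l' : cvgC u l -> cvgC v l' -> cvgC (fun n => u n - v n) (l - l').
Proof. by move=> hu hv; apply: cvgCD => //; exact: cvgCN. Qed.

Lemma cvgC_sum (I : Type) (r : seq I) (P : pred I) (F : I -> nat -> C) (L : I -> C) :
  (forall i, P i -> cvgC (F i) (L i)) ->
  cvgC (fun n => \sum_(i <- r | P i) F i n) (\sum_(i <- r | P i) L i).
Proof.
move=> h; elim: r => [|i r IH].
  by rewrite big_nil; under eq_fun do rewrite big_nil; exact: cvgC_cst.
rewrite big_cons; under eq_fun do rewrite big_cons.
by case: ifP => // Pi; apply: cvgCD => //; exact: h.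
Qed.

Lemma cvgC_nrm_le u l e : cvgC u l -> (exists N, forall n, (N <= n)%N -> nrm (u n) <= e) ->
  nrm l <= e.
Proof.
move=> /cvgCP h [N hN]; rewrite leNgt; apply/negP => el.
have d0 : 0 < nrm l by apply: le_lt_trans el; exact: le_trans (nrm_ge0 hC _) (hN N (leqnn _)).
have [M hM] := h _ d0.
have := hM _ (leq_maxr N M); have := hN _ (leq_maxl N M).
set x := u _ => hx hd; have := nrm_close hC hd => hh.
by move: el; rewrite -hh ltNge hx.
Qed.

Lemma cvgC_bounded u l : cvgC u l -> exists2 B, 0 <= B & exists N, forall n, (N <= n)%N -> nrm (u n) <= B.
Proof.
move=> /cvgCP /(_ 1 ltr01)[N hN]; exists (Num.max 1 (nrm l)); first by rewrite le_max ler01.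
exists N => n /hN /ltW h; rewrite -[u n](subrK l).
by apply: (nrmD_le hC); rewrite le_max ?h ?lexx ?orbT.
Qed.

Lemma cvgCM u v l l' : cvgC u l -> cvgC v l' -> cvgC (fun n => u n * v n) (l * l').
Proof.
move=> hu hv; have [B B0 [N hN]] := cvgC_bounded hu.
have -> : (fun n => u n * v n) = (fun n => u n * (v n - l') + l' * u n).
  by apply/funext => n; rewrite mulrBr (mulrC l') subrK.
rewrite -[l * l']add0r mulrC; apply: cvgCD (cvgCZ _ hu).
have B1 : 0 < Num.max B 1 by rewrite lt_max ltr01 orbT.
apply/cvgCP => e e0; have /cvgCP /(_ (e / Num.max B 1)) [|M hM] := hv.
  exact: divr_gt0.
exists (maxn N M) => n; rewrite geq_max => /andP[n1 n2].
have := hM _ n2; rewrite ltr_pdivlMr // mulrC subr0; apply: le_lt_trans.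
by apply: (nrmM_le hC) => //; rewrite le_max hN.
Qed.

Lemma cvgCX u l k : cvgC u l -> cvgC (fun n => u n ^+ k) (l ^+ k).
Proof.
move=> h; elim: k => [|k IH]; first by rewrite expr0; exact: cvgC_cst.
by rewrite exprS; under eq_fun do rewrite exprS; exact: cvgCM.
Qed.

(* For a nonincreasing rate [r] tending to 0, an ultrametric sequence whose
   n-th step is at most [r n] stays within [r n] of its limit. *)
Definition rate (r : nat -> R) := (forall m n, (m <= n)%N -> r n <= r m) /\
  forall e, 0 < e -> exists N, r N < e.

Lemma rate_cvg r u l : rate r -> (forall n, nrm (u n - l) <= r n) -> cvgC u l.
Proof.
move=> [mono small] h; apply/cvgCP => e /small[N hN]; exists N => n Nn.
exact: le_lt_trans (h n) (le_lt_trans (mono _ _ Nn) hN).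
Qed.

Lemma cvg_rate r u : rate r -> (forall n, nrm (u n.+1 - u n) <= r n) ->
  exists2 l, cvgC u l & forall n, nrm (u n - l) <= r n.
Proof.
move=> [mono small] step.
have far m k : nrm (u (m + k)%N - u m) <= r m.
  elim: k => [|k IH]; first by rewrite addn0 subrr (nrm0 hC) (le_trans (nrm_ge0 hC _) (step m)).
  rewrite addnS; apply: (nrm_dist_le hC (y := u (m + k)%N)) => //.
  by apply: le_trans (step _) (mono _ _ _); exact: leq_addr.
have [|l ul] := nrm_complete hC (u := u).
  move=> e /small[N hN]; exists N => m n Nm Nn.
  apply: (nrm_dist_lt hC (y := u N)); apply: le_lt_trans hN.
    by rewrite -(subnKC Nm); exact: far.
  by rewrite (nrm_distC hC) -(subnKC Nn); exact: far.
exists l => // n; rewrite (nrm_distC hC).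
apply: (@cvgC_nrm_le (fun m => u m - u n)).
  by apply: cvgCB => //; exact: cvgC_cst.
by exists n => m nm; rewrite -(subnKC nm); exact: far.
Qed.

Lemma rateZ K r : 0 <= K -> rate r -> rate (fun n => K * r n).
Proof.
move=> K0 [mono small]; split=> [m n mn|e e0]; first by rewrite ler_wpM2l // mono.
have K1 : 0 < K + 1 by rewrite ltr_wpDl.
have [N hN] := small (e / (K + 1)) (divr_gt0 e0 K1); exists N.
move: hN; rewrite ltr_pdivlMr // => hN.
have [rN|rN] := leP 0 (r N); first by apply: le_lt_trans hN; nra.
by apply: le_lt_trans e0; rewrite mulr_ge0_le0 // ltW.
Qed.

Lemma rate_q : rate (fun n => q ^+ n).
Proof. by split=> [m n mn|e e0]; [exact: ler_qX|exact: qX_small]. Qed.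

Lemma rate_q_half : rate (fun n => q ^+ n./2).
Proof.
split=> [m n mn|e /(qX_small p_prime)[N hN]].
  by apply: ler_qX => //; exact: half_leq.
by exists N.*2; rewrite doubleK.
Qed.

Lemma cvgC_pX : cvgC (fun n => p%:R ^+ n) 0.
Proof. by apply: (rate_cvg rate_q) => n; rewrite subr0 (nrm_pX hC). Qed.

End Limits.

(** * Powers of principal units *)

Section Zp.
Local Open Scope classical_set_scope.
Local Open Scope ring_scope.
Context (R : realType) (p : nat) (C : fieldType) (nrm : C -> R)
  (hC : is_Cp p nrm) (p_prime : prime p) (p_gt2 : (2 < p)%N).
Local Notation q := (p%:R^-1 : R).
Local Notation cvgC := (cvgC nrm).
Local Notation in_Zp := (in_Zp nrm).

Lemma in_Zp_int (z : int) : in_Zp z%:~R.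
Proof. by exists (fun=> z); exact: cvgC_cst hC _. Qed.

Lemma in_Zp_nat (n : nat) : in_Zp n%:R.
Proof. by rewrite pmulrn; exact: in_Zp_int. Qed.

Lemma in_ZpD x y : in_Zp x -> in_Zp y -> in_Zp (x + y).
Proof.
move=> [u hu] [v hv]; exists (fun n => u n + v n).
by under eq_fun do rewrite rmorphD; exact: (cvgCD hC).
Qed.

Lemma in_ZpN x : in_Zp x -> in_Zp (- x).
Proof.
move=> [u hu]; exists (fun n => - u n).
by under eq_fun do rewrite rmorphN; exact: (cvgCN hC).
Qed.

Lemma in_ZpB x y : in_Zp x -> in_Zp y -> in_Zp (x - y).
Proof. by move=> hx hy; apply: in_ZpD => //; exact: in_ZpN. Qed.

Lemma in_Zp_nrm x : in_Zp x -> nrm x <= 1.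
Proof.
move=> [u hu]; apply: (cvgC_nrm_le hC hu); exists 0%N => n _.
exact: (nrm_int hC).
Qed.

(** Adding p^n (|u n| + M) to the integer u n leaves the p-adic limit unchanged and makes the term a
    natural number that is at least M. With M = 1 this yields interpolation points 1 - k different
    from 1. *)
Lemma in_Zp_cvg_nat x M : in_Zp x ->
  exists2 u : nat -> nat, forall n, (M <= u n)%N & cvgC (fun n => (u n)%:R) x.
Proof.
move=> [u hu]; exists (fun n => absz (u n + (p ^ n)%:Z * (`|u n|%N + M)%:Z)) => [n|].
  have : (1 <= p ^ n)%N by rewrite expn_gt0 prime_gt0.
  move: (p ^ n)%N => P P1.
  have : (`|u n|%N + M)%:Z <= P%:Z * (`|u n|%N + M)%:Z by nia.
  lia.
have e n : (absz (u n + (p ^ n)%:Z * (`|u n|%N + M)%:Z))%:R =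
   (u n)%:~R + p%:R ^+ n * (`|u n|%N + M)%:R :> C.
  rewrite -natrX -natrM [LHS]pmulrn [X in _ = _ + X]pmulrn -rmorphD /= gez0_abs //.
  have : (1 <= p ^ n)%N by rewrite expn_gt0 prime_gt0.
  move: (p ^ n)%N => P P1; nia.
under eq_fun do rewrite e.
rewrite -[x]addr0; apply: (cvgCD hC) => //.
apply: (rate_cvg hC (rate_q R p_prime p_gt2)) => n; rewrite subr0.
by rewrite (nrmM hC) (nrm_pX hC) -[leRHS]mulr1 ler_wpM2l ?(qX_ge0 R p_prime) ?(nrm_nat hC).
Qed.

Lemma in_Zp_cvg_1B x M : in_Zp x -> exists2 u : nat -> nat,
  forall n, (M <= u n)%N & cvgC (fun n => 1 - (u n)%:R) x.
Proof.
move=> hx; have [u uM hu] := in_Zp_cvg_nat M (in_ZpB (in_Zp_nat 1) hx).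
exists u => //; rewrite -[x](subKr 1); apply: (cvgCB hC) => //.
exact: (cvgC_cst hC).
Qed.

(** Turns a norm estimate into the congruence modulo p as [teichmuller] phrases it: integers close
    enough to x are divisible by p, and their quotients converge. *)
Lemma in_Zp_divp x : in_Zp x -> nrm x < 1 -> in_Zp (x / p%:R).
Proof.
move=> [u hu] x1; have /(cvgCP hC)/(_ 1 ltr01)[N hN] := hu.
have dv n : (p%:Z %| u (N + n)%N)%Z.
  apply: (nrm_int_lt1 hC p_prime p_gt2).
  by rewrite -[(u _)%:~R](subrK x); apply: (nrmD_lt hC) => //; apply: hN; exact: leq_addr.
exists (fun n => (u (N + n)%N %/ p%:Z)%Z).
have -> : (fun n => ((u (N + n)%N %/ p%:Z)%Z)%:~R) = (fun n => p%:R^-1 * (u (N + n)%N)%:~R :> C).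
  apply/funext => n; apply: (mulfI (p_neq0 hC p_prime)).
  by rewrite mulrA mulfV ?mul1r ?(p_neq0 hC p_prime) // {1}pmulrn -rmorphM mulrC divzK.
rewrite mulrC; apply: (cvgCZ hC); apply/(cvgCP hC) => e e0.
have /(cvgCP hC)/(_ e e0)[N' hN'] := hu; exists N' => n Nn; apply: hN'.
by rewrite (leq_trans Nn) // leq_addl.
Qed.

(** This is where p = 2 would fail, at j = 2. It says that y^j / j is at most |y|^2 when |y| <=
    1/p. *)
Lemma logp_lt j : (1 < j)%N -> (logn p j <= j - 2)%N.
Proof.
move=> j1; have [v0|v0] := posnP (logn p j); first by rewrite v0.
have := dvdn_leq (ltnW j1) (pfactor_dvdnn p j).
have : (3 ^ logn p j <= p ^ logn p j)%N by rewrite leq_exp2r.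
have : (logn p j + 2 <= 3 ^ logn p j)%N.
  elim: (logn p j) v0 => // -[_ //|v /(_ isT)]; rewrite [(3 ^ v.+2)%N]expnS; lia.
lia.
Qed.

(** In the binomial expansion 'C(n, j) = (n / j) 'C(n - 1, j - 1): the factor n comes out of every
    term, and the denominator j is absorbed by y^(j - 2). *)
Lemma pow_linear y n : nrm y <= q ->
  nrm ((1 + y) ^+ n - 1 - n%:R * y) <= nrm n%:R * nrm y ^+ 2.
Proof.
move=> yq.
have [->|n0] := posnP n; first by rewrite expr0 subrr mul0r subr0 (nrm0 hC) mul0r.
have R0 : 0 <= nrm n%:R * nrm y ^+ 2 by rewrite mulr_ge0 ?exprn_ge0 ?(nrm_ge0 hC).
rewrite exprDn.
under eq_bigr do rewrite expr1n mul1r.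
case: n n0 R0 => // n _ R0.
rewrite 2!big_ord_recl /= expr0 bin0 mulr1n expr1 bin1 -mulr_natl.
set S := \sum_(i < n) _.
rewrite (_ : _ - _ = S); last by ring.
rewrite {}/S.
apply: (nrm_sum hC) => // i _.
rewrite -mulr_natl /bump /= !add1n.
set j := i.+2.
have j0 : j%:R != 0 :> C by apply: (natr_neq0 hC p_prime p_gt2).
have -> : 'C(n.+1, j)%:R = n.+1%:R * ('C(n, j.-1)%:R / j%:R) :> C.
  apply: (mulfI j0); rewrite [RHS]mulrCA [j%:R * (_ / _)]mulrCA mulfV // mulr1.
  by rewrite -!natrM -(mul_bin_diag n.+1).
rewrite -2!mulrA 3!(nrmM hC) ler_wpM2l ?(nrm_ge0 hC) // -[leRHS]mul1r.
rewrite ler_pM ?mulr_ge0 ?(nrm_ge0 hC) ?(nrm_nat hC) //.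
rewrite (nrmV hC) (nrm_natE hC p_prime p_gt2) // (nrmX hC) /j -addn2 exprD mulrA.
rewrite -[leRHS]mul1r ler_wpM2r ?exprn_ge0 ?(nrm_ge0 hC) //.
rewrite mulrC ler_pdivrMr ?(qX_gt0 R p_prime) // mul1r.
apply: (@le_trans _ _ (q ^+ i)); first by rewrite lerXn2r ?nnegrE ?(nrm_ge0 hC) ?(ltW (q_gt0 R p_prime)).
apply: (ler_qX R p_prime p_gt2); have := @logp_lt (i + 2) _; lia.
Qed.

(** The linear term n y strictly dominates the remainder of [pow_linear]. Being an equality, this
    gives injectivity of powers as well as their continuity. *)
Lemma pow_nrm y n : nrm y <= q -> nrm ((1 + y) ^+ n - 1) = nrm n%:R * nrm y.
Proof.
move=> yq; have [->|y0] := eqVneq y 0.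
  by rewrite addr0 expr1n subrr (nrm0 hC) mulr0.
have [->|n0] := posnP n; first by rewrite expr0 subrr (nrm0 hC) mul0r.
have n1 := natr_neq0 hC p_prime p_gt2 n0.
rewrite -(nrmM hC); apply: (nrm_close hC).
apply: le_lt_trans (pow_linear _ yq) _.
rewrite (nrmM hC) ltr_pM2l ?(nrm_gt0 hC) // expr2 gtr_pMr ?(nrm_gt0 hC) //.
by apply: le_lt_trans yq _; exact: q_lt1.
Qed.

Lemma nrm_le_1q x : nrm (x - 1) <= q -> nrm x = 1.
Proof.
move=> h; rewrite (nrm_close hC (x := 1)) ?(nrm1 hC) //.
exact: le_lt_trans h (q_lt1 R p_prime p_gt2).
Qed.

Lemma pow_lip x m n : nrm (x - 1) <= q ->
  nrm (x ^+ m - x ^+ n) = nrm (x - 1) * nrm (m%:R - n%:R).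
Proof.
move=> hx; wlog mn : m n / (n <= m)%N.
  by move=> h; case: (leqP n m) => [/h //|/ltnW/h]; rewrite (nrm_distC hC) [RHS]mulrC (nrm_distC hC m%:R) mulrC.
rewrite -natrB // -{1}(subnKC mn) exprD -{2}[x ^+ n]mulr1 -mulrBr (nrmM hC).
rewrite (nrmX hC) (nrm_le_1q hx) expr1n mul1r mulrC.
by rewrite -(pow_nrm (m - n) hx) [1 + _]addrC subrK.
Qed.

Lemma exprn_lip x y n : nrm x <= 1 -> nrm y <= 1 -> nrm (x ^+ n - y ^+ n) <= nrm (x - y).
Proof.
move=> hx hy; elim: n => [|n IH]; first by rewrite subrr (nrm0 hC) (nrm_ge0 hC).
have -> : x ^+ n.+1 - y ^+ n.+1 = x * (x ^+ n - y ^+ n) + (x - y) * y ^+ n.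
  by rewrite !exprS; ring.
apply: (nrmD_le hC); first exact: (nrmM_le1l hC).
by apply: (nrmM_le1r hC) => //; exact: (nrmX_le1 hC).
Qed.

Local Notation padic_pow := (padic_pow nrm).

Lemma padic_powP x s u : nrm (x - 1) <= q -> in_Zp s ->
  cvgC (fun n => (u n)%:R) s -> cvgC (fun n => x ^+ u n) (padic_pow x s).
Proof.
move=> hx hs hu.
suff ex : [set y : C | forall u : nat -> nat,
    cvgC (fun n => (u n)%:R) s -> cvgC (fun n => x ^+ u n) y] (padic_pow x s).
  exact: ex.
have [v _ hv] := in_Zp_cvg_nat 0 hs.
(* The definition asks for one limit valid for all sequences tending to s; since x^a - x^b is no
   larger than a - b, the limit along one sequence serves for every other. *)
have lip (w1 w2 : nat -> nat) y : cvgC (fun n => (w1 n)%:R) s -> cvgC (fun n => (w2 n)%:R) s ->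
    cvgC (fun n => x ^+ w1 n) y -> cvgC (fun n => x ^+ w2 n) y.
  move=> h1 h2 h3.
  have d : cvgC (fun n => x ^+ w2 n - x ^+ w1 n) 0.
    apply: (cvgC_lip hC (K := 1) (u := fun n => (w2 n)%:R - (w1 n)%:R) (l := 0)) => [n|].
      rewrite !subr0 pow_lip // ler_wpM2r ?(nrm_ge0 hC) // (le_trans hx) //.
      by rewrite ltW // q_lt1.
    by rewrite -(subrr s); exact: (cvgCB hC).
  have := cvgCD hC d h3; rewrite add0r; under eq_fun do rewrite subrK.
  by [].
have [|y hy] := nrm_complete hC (u := fun n => x ^+ v n).
  move=> e e0; have /(cvgCP hC)/(_ e e0)[N hN] := hv; exists N => m n Nm Nn.
  rewrite pow_lip //; apply: (@le_lt_trans _ _ (nrm ((v m)%:R - (v n)%:R))).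
    rewrite -[leRHS]mul1r ler_wpM2r ?(nrm_ge0 hC) // (le_trans hx) //.
    by rewrite ltW // q_lt1.
  by apply: (nrm_dist_lt hC (y := s)); [exact: hN|rewrite (nrm_distC hC); exact: hN].
apply: (@xgetPex _ 0 [set y : C | forall u : nat -> nat,
    cvgC (fun n => (u n)%:R) s -> cvgC (fun n => x ^+ u n) y]).
by exists y => w hw; exact: lip hv hw hy.
Qed.

Lemma padic_pow_nat x k : nrm (x - 1) <= q -> padic_pow x k%:R = x ^+ k.
Proof.
move=> hx; apply: (cvgC_unique hC (padic_powP (u := fun=> k) hx (in_Zp_nat k) (cvgC_cst hC _))).
exact: cvgC_cst hC _.
Qed.

Lemma padic_pow_lip x s t : nrm (x - 1) <= q -> in_Zp s -> in_Zp t ->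
  nrm (padic_pow x s - padic_pow x t) = nrm (x - 1) * nrm (s - t).
Proof.
move=> hx hs ht.
have [u _ hu] := in_Zp_cvg_nat 0 hs; have [v _ hv] := in_Zp_cvg_nat 0 ht.
have [->|st] := eqVneq s t; first by rewrite !subrr (nrm0 hC) mulr0.
have h1 := cvgCB hC (padic_powP hx hs hu) (padic_powP hx ht hv).
have h2 := cvgCB hC hu hv.
have st0 : s - t != 0 by rewrite subr_eq0.
have [x1|x1] := eqVneq x 1.
  rewrite x1 subrr (nrm0 hC) mul0r.
  have p1 : padic_pow 1 s = 1 /\ padic_pow 1 t = 1.
    rewrite -x1; split; [have := padic_powP hx hs hu|have := padic_powP hx ht hv];
      rewrite x1; under eq_fun do rewrite expr1n;
      by move=> h; apply: (cvgC_unique hC h); exact: cvgC_cst hC _.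
  by rewrite p1.1 p1.2 subrr (nrm0 hC).
have c0 : 0 < nrm (x - 1) by rewrite (nrm_gt0 hC) // subr_eq0.
have e0 : 0 < nrm (s - t) by exact: (nrm_gt0 hC).
have /(cvgCP hC)/(_ _ e0)[N hN] := h2.
(* Norms of a sequence with nonzero limit are eventually constant, so the equality of [pow_lip]
   passes to the limit as an equality. *)
have near n : (N <= n)%N -> nrm (x ^+ u n - x ^+ v n) = nrm (x - 1) * nrm (s - t).
  by move=> Nn; rewrite pow_lip // (nrm_close hC (hN _ Nn)).
have /(cvgCP hC)/(_ _ (mulr_gt0 c0 e0))[N' hN'] := h1.
have := hN' _ (leq_maxr N N'); rewrite -(near _ (leq_maxl N N')) (nrm_distC hC).
by move/(nrm_close hC).
Qed.

Lemma padic_pow_eq1 x s : nrm (x - 1) <= q -> in_Zp s -> x != 1 -> padic_pow x s = 1 -> s = 0.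
Proof.
move=> hx hs x1 e; have := padic_pow_lip hx hs (in_Zp_nat 0).
rewrite padic_pow_nat // expr0 e subr0 subrr (nrm0 hC) => /esym/eqP.
rewrite mulf_eq0 => /orP[]/eqP/(nrm_eq0 hC)/eqP; rewrite ?subr_eq0 ?(negPf x1) //.
by move/eqP.
Qed.

Lemma expr_near1 x N : nrm (x - 1) <= q -> nrm (x ^+ N - 1) <= q.
Proof.
move=> hx; have := pow_lip N 0 hx; rewrite expr0 subr0 => ->.
by apply: le_trans hx; rewrite -[leRHS]mulr1 ler_wpM2l ?(nrm_ge0 hC) // (nrm_nat hC).
Qed.

Lemma padic_powX x s N : nrm (x - 1) <= q -> in_Zp s ->
  padic_pow x s ^+ N = padic_pow (x ^+ N) s.
Proof.
move=> hx hs; have [u _ hu] := in_Zp_cvg_nat 0 hs.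
apply: (cvgC_unique hC (cvgCX hC N (padic_powP hx hs hu))).
by under eq_fun do rewrite exprAC; apply: padic_powP => //; exact: expr_near1.
Qed.

Lemma padic_pow_base_lip x y s : nrm (x - 1) <= q -> nrm (y - 1) <= q -> in_Zp s ->
  nrm (padic_pow x s - padic_pow y s) <= nrm (x - y).
Proof.
move=> hx hy hs; have [u _ hu] := in_Zp_cvg_nat 0 hs.
apply: (cvgC_nrm_le hC (cvgCB hC (padic_powP hx hs hu) (padic_powP hy hs hu))).
exists 0%N => n _; apply: exprn_lip; rewrite (nrm_le_1q (x := _)) //.
Qed.

End Zp.

(** * The Teichmueller character *)

Section Teichmuller.
Local Open Scope classical_set_scope.
Local Open Scope ring_scope.
Context (R : realType) (p : nat) (C : fieldType) (nrm : C -> R)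
  (hC : is_Cp p nrm) (p_prime : prime p) (p_gt2 : (2 < p)%N).
Local Notation q := (p%:R^-1 : R).
Local Notation cvgC := (cvgC nrm).
Local Notation in_Zp := (in_Zp nrm).
Local Notation omega := (omega nrm p).
Local Notation angle := (angle nrm p).

Lemma p1_unit : nrm p.-1%:R = 1.
Proof.
apply: (nrm_nat_unit hC p_prime p_gt2); apply/negP => /dvdn_leq; lia.
Qed.

Lemma root_nrm z n : (0 < n)%N -> z ^+ n = 1 -> nrm z = 1.
Proof.
move=> n0 h; apply/eqP; rewrite -(pexpr_eq1 n0) ?(nrm_ge0 hC) //.
by rewrite -(nrmX hC) h (nrm1 hC).
Qed.

Lemma p1_gt0 : (0 < p.-1)%N. Proof. lia. Qed.

(** The quotient z / z' is a principal unit 1 + y with (1 + y)^(p - 1) = 1, and [pow_nrm] gives |p -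
    1| |y| = 0 with |p - 1| = 1. *)
Lemma root_unique z z' : z ^+ p.-1 = 1 -> z' ^+ p.-1 = 1 -> nrm (z - z') <= q -> z = z'.
Proof.
move=> h h' d; have n' := root_nrm p1_gt0 h'.
have z'0 : z' != 0 by apply/eqP => e; move: n'; rewrite e (nrm0 hC) => /eqP; rewrite eq_sym oner_eq0.
have d' : nrm (z / z' - 1) <= q.
  by rewrite -(mulfV z'0) -mulrBl (nrm_div hC) n' divr1.
have := pow_nrm hC p_prime p_gt2 p.-1 d'.
rewrite [1 + _]addrC subrK expr_div_n h h' divr1 subrr (nrm0 hC) p1_unit mul1r.
by move=> /esym/(nrm_eq0 hC)/eqP; rewrite subr_eq0 => /eqP /(canRL (divfK z'0)); rewrite mul1r.
Qed.

Lemma fermat_nrm (a : int) : ~~ (p%:Z %| a)%Z -> nrm (a%:~R ^+ p.-1 - 1) <= q.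
Proof.
move=> pa; have na := nrm_int_unit hC p_prime p_gt2 pa.
have p0 : p%:Z != 0 by lia.
(* Fermat's little theorem is available for natural numbers, so a is replaced by its residue r. *)
have [r ar] : exists r : nat, (p%:Z %| a - r%:Z)%Z.
  exists (absz (a %% p%:Z)%Z); rewrite gez0_abs ?modz_ge0 //.
  by rewrite {1}(divz_eq a p%:Z) addrK dvdz_mull.
have dn : nrm (a%:~R - r%:R) <= q.
  by rewrite pmulrn -rmorphB -[q]expr1; apply: (nrm_int_dvd hC); rewrite expr1.
suff : nrm (a%:~R ^+ p - a%:~R) <= q.
  have -> : a%:~R ^+ p - a%:~R = a%:~R * (a%:~R ^+ p.-1 - 1) :> C.
    by rewrite mulrBr mulr1 -exprS prednK ?prime_gt0.
  by rewrite (nrmM hC) na mul1r.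
apply: (nrm_dist_le hC (y := r%:R ^+ p)).
  apply: le_trans (exprn_lip hC _ _ _) dn; first by rewrite na.
  exact: nrm_nat hC _.
apply: (nrm_dist_le hC (y := r%:R)); last by rewrite (nrm_distC hC).
have /eqP := fermat_little r p_prime.
have le : (r <= r ^ p)%N.
  case: (r) => // s; rewrite -[X in (X <= _)%N]expn1 leq_pexp2l // prime_gt0 //.
rewrite eqn_mod_dvd // => dv.
rewrite -natrX -natrB // pmulrn -[q]expr1; apply: (nrm_int_dvd hC).
by rewrite expr1 dvdzE.
Qed.

(** The root is the limit of a^(p^n). Consecutive terms differ by the factor b^(p^n), where b = a^(p
    - 1) is a principal unit by Fermat, so the n-th step is at most p^-(n+1); hence the limit stays
    within 1/p of the term a at n = 0. *)
Lemma teich_exists (a : int) : ~~ (p%:Z %| a)%Z ->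
  exists z, [/\ in_Zp z, z ^+ p.-1 = 1 & nrm (z - a%:~R) <= q].
Proof.
move=> pa; have na := nrm_int_unit hC p_prime p_gt2 pa.
set b : C := a%:~R ^+ p.-1; have hb : nrm (b - 1) <= q by exact: fermat_nrm.
pose u n : C := (a ^+ (p ^ n))%:~R.
have ub n : u n ^+ p.-1 = b ^+ (p ^ n) by rewrite /u rmorphXn /= exprAC.
have b1 n : nrm (b ^+ (p ^ n) - 1) <= q ^+ n.+1.
  have -> : b = 1 + (b - 1) by rewrite addrC subrK.
  rewrite (pow_nrm hC p_prime p_gt2) // natrX (nrm_pX hC) exprSr.
  by rewrite ler_wpM2l ?(qX_ge0 R p_prime).
have [|z hz far] := cvg_rate hC (u := u) (rateZ (ltW (q_gt0 R p_prime)) (rate_q R p_prime p_gt2)).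
  move=> n; have -> : u n.+1 - u n = u n * (b ^+ (p ^ n) - 1).
    rewrite mulrBr mulr1 -ub -exprS prednK ?prime_gt0 // /u expnSr exprM rmorphXn //.
  rewrite -exprS (nrmM_le1l hC) // /u rmorphXn /= (nrmX_le1 hC) // na //.
exists z; split.
- by exists (fun n => a ^+ (p ^ n)).
- apply: (cvgC_unique hC (cvgCX hC p.-1 hz)).
  apply: (rate_cvg hC (r := fun n => q * q ^+ n) (rateZ (ltW (q_gt0 R p_prime)) (rate_q R p_prime p_gt2))).
  by move=> n; rewrite ub -exprS.
- by rewrite (nrm_distC hC); have := far 0%N; rewrite /u expn0 !expr1 expr0 mulr1.
Qed.

Lemma omegaP (a : int) : ~~ (p%:Z %| a)%Z ->
  [/\ in_Zp (omega a), omega a ^+ p.-1 = 1 & nrm (omega a - a%:~R) <= q].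
Proof.
move=> pa; have [z [h1 h2 h3]] := teich_exists pa.
have : [set z : C | [/\ in_Zp z, z ^+ p.-1 = 1
                        & in_Zp ((z - a%:~R) / p%:R)]] (omega a).
  apply: xgetPex; exists z; split => //; apply: (in_Zp_divp hC p_prime p_gt2).
    by apply: (in_ZpB hC) => //; exact: in_Zp_int hC _.
  exact: le_lt_trans h3 (q_lt1 R p_prime p_gt2).
move=> [k1 k2 k3]; split=> //.
have := in_Zp_nrm hC k3; rewrite (nrm_div hC) (nrm_p hC) ler_pdivrMr ?mul1r //.
exact: q_gt0.
Qed.

Lemma omega_unique (a : int) z : ~~ (p%:Z %| a)%Z -> z ^+ p.-1 = 1 ->
  nrm (z - a%:~R) <= q -> omega a = z.
Proof.
move=> pa hz za; have [_ h1 h2] := omegaP pa.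
by apply: root_unique => //; apply: (nrm_dist_le hC) h2 _; rewrite (nrm_distC hC).
Qed.

Lemma omega_nrm (a : int) : ~~ (p%:Z %| a)%Z -> nrm (omega a) = 1.
Proof. by move=> /omegaP[_ h _]; exact: root_nrm p1_gt0 h. Qed.

Lemma omega_neq0 (a : int) : ~~ (p%:Z %| a)%Z -> omega a != 0.
Proof.
move=> /omega_nrm h; apply/eqP => e; move: h; rewrite e (nrm0 hC) => /eqP.
by rewrite eq_sym oner_eq0.
Qed.

Lemma prime_ndvdzM (a b : int) : ~~ (p%:Z %| a)%Z -> ~~ (p%:Z %| b)%Z -> ~~ (p%:Z %| a * b)%Z.
Proof. by rewrite !dvdzE abszM /= Euclid_dvdM // negb_or => -> ->. Qed.

Lemma omegaM (a b : int) : ~~ (p%:Z %| a)%Z -> ~~ (p%:Z %| b)%Z ->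
  omega (a * b) = omega a * omega b.
Proof.
move=> pa pb; have [_ a1 a2] := omegaP pa; have [_ b1 b2] := omegaP pb.
apply: omega_unique; first exact: prime_ndvdzM.
  by rewrite exprMn a1 b1 mulr1.
have -> : omega a * omega b - (a * b)%:~R =
  omega a * (omega b - b%:~R) + (omega a - a%:~R) * b%:~R by rewrite rmorphM /=; ring.
apply: (nrmD_le hC); first by rewrite (nrmM hC) omega_nrm ?mul1r.
by apply: (nrmM_le1r hC) => //; exact: nrm_int hC _.
Qed.

Lemma omega_mod (a b : int) : ~~ (p%:Z %| a)%Z -> ~~ (p%:Z %| b)%Z -> (p%:Z %| a - b)%Z -> omega a = omega b.
Proof.
move=> pa pb ab; have [_ b1 b2] := omegaP pb; apply: omega_unique => //.
apply: (nrm_dist_le hC) b2 _; rewrite -rmorphB -[q]expr1; apply: (nrm_int_dvd hC).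
by rewrite expr1 -opprB dvdzE abszN -dvdzE.
Qed.

Lemma angleE (a : int) : ~~ (p%:Z %| a)%Z -> a%:~R = angle a * omega a.
Proof. by move=> pa; rewrite /angle divfK // omega_neq0. Qed.

Lemma angle_near1 (a : int) : ~~ (p%:Z %| a)%Z -> nrm (angle a - 1) <= q.
Proof.
move=> pa; have [_ _] := omegaP pa; rewrite (nrm_distC hC).
have -> : angle a - 1 = (a%:~R - omega a) / omega a by rewrite mulrBl mulfV ?omega_neq0.
by rewrite (nrm_div hC) omega_nrm // divr1.
Qed.

Lemma angle_lip (a b : int) : ~~ (p%:Z %| a)%Z -> ~~ (p%:Z %| b)%Z -> (p%:Z %| a - b)%Z ->
  nrm (angle a - angle b) = nrm (a%:~R - b%:~R).
Proof.
move=> pa pb ab; rewrite /angle (omega_mod pa pb ab) -mulrBl (nrm_div hC).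
by rewrite omega_nrm // divr1.
Qed.

(** The exponent p - 1 removes omega(2), leaving the natural number 2^(N (p - 1)), which differs
    from 1 in characteristic 0. *)
Lemma angle2_X_neq1 N : (0 < N)%N -> angle 2 ^+ (N * p.-1) != 1.
Proof.
move=> N0; have p2 : ~~ (p%:Z %| 2)%Z.
  by rewrite dvdzE /=; apply/negP => /dvdn_leq; lia.
have [_ w1 _] := omegaP p2.
rewrite /angle expr_div_n [_ ^+ (N * _) in X in _ / X]exprM exprAC w1 expr1n divr1.
apply/eqP => e; have := @natr_inj _ _ _ _ hC p_prime p_gt2 (2 ^ (N * p.-1))%N 1%N.
rewrite natrX => /(_ e) /eqP; rewrite -[X in _ == X](expn0 2) eqn_exp2l // muln_eq0.
have := p1_gt0; lia.
Qed.

End Teichmuller.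

(** * Dirichlet characters of p-power conductor *)

Section Characters.
Local Open Scope classical_set_scope.
Local Open Scope ring_scope.
Context (C : fieldType).

Lemma dirichlet1 f (chi : int -> C) : dirichlet_char f chi -> chi 1 = 1.
Proof.
move=> [_ m _ nz]; have := nz 1; rewrite coprimezE coprime1n => h.
have := m 1 1; rewrite mulr1 => /esym/eqP; rewrite -subr_eq0 -{3}[chi 1]mulr1 -mulrBr.
by rewrite mulf_eq0 (negPf h) subr_eq0 => /eqP.
Qed.

Lemma dirichlet_mod f (chi : int -> C) a b : dirichlet_char f chi ->
  (f%:Z %| a - b)%Z -> chi a = chi b.
Proof.
move=> [_ _ per _] /dvdzP[z e].
have pern c (n : nat) : chi (c + n%:Z * f%:Z) = chi c.
  elim: n => [|n IH]; first by rewrite mul0r addr0.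
  by rewrite intS mulrDl mul1r addrCA addrC per.
have -> : a = b + z * f%:Z by rewrite -e addrC subrK.
case: z {e} => n; first exact: pern.
by rewrite -(pern (b + Negz n * f%:Z) n.+1) NegzE mulNr subrK.
Qed.

Lemma dirichletX f (chi : int -> C) a n : dirichlet_char f chi -> chi (a ^+ n) = chi a ^+ n.
Proof.
move=> d; elim: n => [|n IH]; first by rewrite !expr0 (dirichlet1 d).
by case: (d) => _ m _ _; rewrite !exprS m IH.
Qed.

Lemma dirichlet_root f (chi : int -> C) a : dirichlet_char f chi ->
  coprimez a f%:Z -> chi a ^+ totient f = 1.
Proof.
move=> d cop; case: (d) => f0 _ _ _.
rewrite -(dirichletX a _ d) -(dirichlet1 d).
have f0' : f%:Z != 0 by lia.
set r := absz (a %% f%:Z)%Z.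
have ar : r%:Z = (a %% f%:Z)%Z by rewrite gez0_abs ?modz_ge0.
have copr : coprime r f.
  by have := cop; rewrite /coprimez -gcdz_modl -ar.
apply: (dirichlet_mod d); rewrite -eqz_mod_dvd -modzXm -ar.
rewrite (_ : _ ^+ _ = (r ^ totient f)%N%:Z) ?modz_nat; last by rewrite -!natz natrX.
by rewrite Euler_exp_totient.
Qed.

End Characters.

Section PPowerCharacters.
Local Open Scope classical_set_scope.
Local Open Scope ring_scope.
Context (R : realType) (p : nat) (C : fieldType) (nrm : C -> R)
  (hC : is_Cp p nrm) (p_prime : prime p) (p_gt2 : (2 < p)%N).
Local Notation omega := (omega nrm p).

Lemma coprimez_pX (a : int) m : ~~ (p%:Z %| a)%Z -> coprimez a (p ^ m)%N%:Z.
Proof.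
move=> pa; rewrite coprimezE /= coprime_sym coprimeXl // prime_coprime //.
Qed.

(** The p-free part u of f is prime to p, so chi(u) is nonzero and u is coprime to f; dividing f, it
    must be 1. *)
Lemma dirichlet_coprime_p f (chi : int -> C) : dirichlet_char f chi ->
  (forall a, ~~ (p%:Z %| a)%Z -> chi a != 0) -> exists r, f = (p ^ r)%N.
Proof.
move=> [f0 _ _ nz] h; exists (logn p f).
have [u pu e] := pfactor_coprime p_prime f0.
rewrite {1}e; suff -> : u = 1%N by rewrite mul1n.
apply/eqP; apply/negPn/negP => u1.
have u0 : (0 < u)%N by move: f0; rewrite e muln_gt0 => /andP[].
have /h : ~~ (p%:Z %| u%:Z)%Z by rewrite dvdzE /= -prime_coprime.
rewrite nz coprimezE /= e => /coprime_dvdr-/(_ u (dvdn_mulr _ (dvdnn u))).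
by rewrite /coprime gcdnn (negPf u1).
Qed.

(** Extending phi by 0 on multiples of p gives a character modulo p^M, where M > 0 makes the zeros
    the right ones. The least exponent r for which some character modulo p^r agrees with phi off p
    then gives a primitive one. *)
Lemma associated_primitive_exists (phi : int -> C) M : (0 < M)%N ->
  (forall a, ~~ (p%:Z %| a)%Z -> phi a != 0) ->
  (forall a b, ~~ (p%:Z %| a)%Z -> ~~ (p%:Z %| b)%Z -> phi (a * b) = phi a * phi b) ->
  (forall a, ~~ (p%:Z %| a)%Z -> phi (a + (p ^ M)%N%:Z) = phi a) ->
  (exists r, primitive_char (p ^ r) (associated_primitive p phi)) /\
  (forall a, ~~ (p%:Z %| a)%Z -> associated_primitive p phi a = phi a).
Proof.
move=> M0 phi0 phiM phiP.
have pM : (p%:Z %| (p ^ M)%N%:Z)%Z by rewrite dvdzE /= dvdn_exp.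
pose P r := `[< exists psi : int -> C, dirichlet_char (p ^ r) psi /\
   forall a, ~~ (p%:Z %| a)%Z -> psi a = phi a >].
have exP : exists r, P r.
  exists M; apply/asboolP; exists (fun a => if (p%:Z %| a)%Z then 0 else phi a); split; last first.
    by move=> a /negPf ->.
  split; first by rewrite expn_gt0 prime_gt0.
  - move=> a b; have [pa|pa] := boolP (p%:Z %| a)%Z; first by rewrite dvdz_mulr // mul0r.
    have [pb|pb] := boolP (p%:Z %| b)%Z; first by rewrite dvdz_mull // mulr0.
    by rewrite (negPf (prime_ndvdzM p_prime pa pb)) phiM.
  - by move=> a; rewrite (rpredDr _ pM); case: ifPn => // /phiP.
  - move=> a; have [pa|pa] := boolP (p%:Z %| a)%Z; last by rewrite phi0 // coprimez_pX.
    rewrite eqxx; apply/esym/negP; rewrite coprimezE /= => /coprime_dvdl.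
    rewrite dvdzE in pa; move=> /(_ _ pa); rewrite prime_coprime // dvdn_exp //.
pose r := ex_minn exP.
have prim : exists psi : int -> C, primitive_char (p ^ r) psi /\ forall a, ~~ (p%:Z %| a)%Z -> psi a = phi a.
  rewrite /r; case: ex_minnP => {}r /asboolP[psi [dpsi agree]] rmin.
  exists psi; split=> //; split=> // d psi' /(dvdn_pfactor _ _ p_prime)[j jr ->] dpsi' agree'.
  congr (_ ^ _)%N; apply/eqP; rewrite eqn_leq jr /=; apply: rmin; apply/asboolP.
  exists psi'; split=> // a pa; rewrite -agree // agree' //; exact: coprimez_pX.
have [psi [hpsi agree]] := prim.
have [[f hf] ha] : [set psi : int -> C |
    (exists f : nat, primitive_char f psi) /\
    forall a : int, ~~ (p%:Z %| a)%Z -> psi a = phi a] (associated_primitive p phi).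
  by apply: xgetPex; exists psi; split=> //; exists (p ^ r)%N.
split=> //.
(* [xget] may return a primitive character other than the one built, with an unknown modulus f; its
   values off p force f to be a power of p. *)
have [s fs] : exists s, f = (p ^ s)%N.
  by apply: (@dirichlet_coprime_p f (associated_primitive p phi)) => //; [case: hf|move=> a pa; rewrite ha ?phi0].
by exists s; rewrite -fs.
Qed.

Lemma omega_periodic (a : int) M : (0 < M)%N -> ~~ (p%:Z %| a)%Z ->
  omega (a + (p ^ M)%N%:Z) = omega a.
Proof.
move=> M0 pa; have pM : (p%:Z %| (p ^ M)%N%:Z)%Z by rewrite dvdzE /= dvdn_exp.
apply: (omega_mod hC) => //; first by rewrite (rpredDr _ pM).
by rewrite (addrC a) addrK.
Qed.

(** The modulus p^(max(m, 1)) is needed when m = 0, since omega still has period p. *)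
Lemma twistP (chi : int -> C) m k : dirichlet_char (p ^ m) chi ->
  (exists r, primitive_char (p ^ r) (twist nrm p chi k)) /\
  (forall a, ~~ (p%:Z %| a)%Z -> twist nrm p chi k a = chi a * omega a ^- k).
Proof.
move=> d; case: (d) => _ mul per nz.
apply: (@associated_primitive_exists _ (maxn m 1)); first by rewrite leq_maxr.
- by move=> a pa; rewrite mulf_neq0 ?invr_eq0 ?expf_neq0 ?(omega_neq0 hC) // nz coprimez_pX.
- move=> a b pa pb; rewrite mul (omegaM hC) // exprMn invfM; ring.
- move=> a pa; rewrite omega_periodic // ?leq_maxr //; congr (_ * _).
  apply: (dirichlet_mod d); by rewrite (addrC a) addrK dvdzE /= dvdn_exp2l // leq_maxl.
Qed.

Lemma omega_powP (j : int) :
  (exists r, primitive_char (p ^ r) (omega_pow nrm p j)) /\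
  (forall a, ~~ (p%:Z %| a)%Z -> omega_pow nrm p j a = omega a ^ j).
Proof.
apply: (@associated_primitive_exists _ 1) => //.
- by move=> a pa; rewrite expfz_neq0 // (omega_neq0 hC).
- by move=> a b pa pb; rewrite (omegaM hC) // expfzMl.
- by move=> a pa; rewrite omega_periodic.
Qed.

End PPowerCharacters.

(** * Generalized Bernoulli numbers as limits of power sums *)

Section FormalPowerSeries.
Context (C : fieldType).
Implicit Types u v w : nat -> C.

(** Truncation turns convolution into polynomial multiplication, from which [fps_mulA] inherits
    associativity. *)
Lemma fps_mul_poly u v n N : (n < N)%N ->
  fps_mul u v n = (\poly_(i < N) u i * \poly_(i < N) v i)`_n.
Proof.
move=> nN; rewrite coefM; apply: eq_bigr => i _; rewrite !coef_poly.
have -> : (i < N)%N by apply: leq_ltn_trans nN; rewrite -ltnS.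
by have -> : (n - i < N)%N by apply: leq_ltn_trans nN; exact: leq_subr.
Qed.

Lemma fps_mulA u v w : fps_mul (fps_mul u v) w = fps_mul u (fps_mul v w).
Proof.
apply/funext => n; set P := fun u : nat -> C => \poly_(i < n.+1) u i.
transitivity ((P u * P v * P w)`_n); last rewrite -mulrA.
  rewrite [RHS]coefM; apply: eq_bigr => i _.
  rewrite (fps_mul_poly u v (N := n.+1)) // [(P w)`_ _]coef_poly.
  by rewrite ltnS leq_subr.
rewrite [LHS]coefM; apply: eq_bigr => i _.
rewrite (fps_mul_poly v w (N := n.+1)) ?ltnS ?leq_subr //.
by rewrite [(P u)`_ _]coef_poly ltn_ord.
Qed.

Lemma fps_mulDr u v w : fps_mul u (fun k => v k + w k) = (fun k => fps_mul u v k + fps_mul u w k).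
Proof.
by apply/funext => n; rewrite /fps_mul -big_split; apply: eq_bigr => i _; rewrite mulrDr.
Qed.

Lemma fps_mul_suml (I : Type) (r : seq I) (P : pred I) (c : I -> C) (F : I -> nat -> C) w n :
  fps_mul (fun k => \sum_(i <- r | P i) c i * F i k) w n =
  \sum_(i <- r | P i) c i * fps_mul (F i) w n.
Proof.
rewrite /fps_mul; under eq_bigr do rewrite mulr_suml.
rewrite exchange_big; apply: eq_bigr => i _; rewrite mulr_sumr.
by apply: eq_bigr => j _; rewrite mulrA.
Qed.

Lemma fps_mulX0 v : fps_mul (fun k => (k == 1%N)%:R) v 0 = 0.
Proof. by rewrite /fps_mul big_ord1 mul0r. Qed.

Lemma fps_mulXS v n : fps_mul (fun k => (k == 1%N)%:R) v n.+1 = v n.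
Proof.
rewrite /fps_mul 2!big_ord_recl /= mul0r add0r mul1r subSS subn0.
by rewrite big1 ?addr0 // => i _; rewrite mul0r.
Qed.

Hypothesis char0 : forall n, n`!%:R != 0 :> C.

Lemma fps_expD (a b : C) : fps_mul (fps_exp a) (fps_exp b) = fps_exp (a + b).
Proof.
apply/funext => n; rewrite /fps_exp /fps_mul addrC exprDn mulr_suml.
apply: eq_bigr => i _.
have le : (i <= n)%N by rewrite -ltnS.
rewrite -[_ *+ 'C(n, i)]mulr_natr -(bin_fact le) 2!natrM.
have h : 'C(n, i)%:R != 0 :> C.
  by have := char0 n; rewrite -(bin_fact le) natrM mulf_eq0 negb_or => /andP[].
by field; rewrite !char0 h.
Qed.

Lemma fps_exp0 k : fps_exp (0 : C) k = (k == 0%N)%:R.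
Proof. by case: k => [|k]; rewrite /fps_exp ?expr0 ?fact0 ?divr1 // expr0n mul0r. Qed.

Lemma recursive_seq (G : nat -> (nat -> C) -> C) : exists b : nat -> C,
  forall n, b n = G n (fun i => if (i < n)%N then b i else 0).
Proof.
pose fix s n := if n is n'.+1 then rcons (s n') (G n' (nth 0 (s n'))) else [::].
have sz n : size (s n) = n by elim: n => //= n IH; rewrite size_rcons IH.
have pre n i : (i < n)%N -> nth 0 (s n) i = nth 0 (s i.+1) i.
  elim: n => // n IH; rewrite ltnS leq_eqVlt => /orP[/eqP -> //|lt].
  by rewrite -IH //= nth_rcons sz lt.
exists (fun n => nth 0 (s n.+1) n) => n /=.
rewrite nth_rcons sz ltnn eqxx; congr (G n _); apply/funext => i.
case: ifPn => [lt|]; first by rewrite pre.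
by rewrite -leqNgt => ge; rewrite nth_default // sz.
Qed.

(** The series e^(ft) - 1 starts with f t, so the equation at index n + 1 determines B_n from the
    earlier numbers, and the one at index 0 reads 0 = 0. *)
Lemma gen_bernoulli_exists f (psi : int -> C) : f%:R != 0 :> C ->
  exists B, gen_bernoulli f psi B.
Proof.
move=> f0.
pose rhs n := \sum_(1 <= a < f.+1)
      psi a%:Z * fps_mul (fun k => (k == 1%N)%:R) (fps_exp a%:R) n.
pose e k : C := fps_exp f%:R k - (k == 0%N)%:R.
have [B hB] := recursive_seq (fun n b => n`!%:R / f%:R *
  (rhs n.+1 - \sum_(i < n) b i / i`!%:R * e (n.+1 - i)%N)).
exists B => n; rewrite -/(rhs n) -[fps_mul _ _ _]/(\sum_(i < n.+1) B i / i`!%:R * e (n - i)%N).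
rewrite big_ord_recr /= subnn {2}/e /fps_exp expr0 fact0 divr1 subrr mulr0 addr0.
case: n => [|n]; first by rewrite big_ord0 /rhs big1 // => a _; rewrite fps_mulX0 mulr0.
rewrite big_ord_recr /= subSnn {2}/e /fps_exp expr1 factS fact0 muln1 divr1 subr0.
rewrite hB; set S := \sum_(i < n) _; set S' := \sum_(i < n) _.
have -> : S' = S by apply: eq_bigr => i _; rewrite ltn_ord.
by field; rewrite char0 f0.
Qed.

(** Induction on M through e^(f(M+1)t) - 1 = (e^(fMt) - 1) + (e^(ft) - 1) e^(fMt): by periodicity
    the last term accounts for the new block of residues fM < a <= f(M+1). *)
Lemma gen_bernoulli_multiple f (psi : int -> C) B M :
  (forall a, psi (a + f%:Z) = psi a) -> gen_bernoulli f psi B ->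
  gen_bernoulli (f * M) psi B.
Proof.
move=> per hB; rewrite /gen_bernoulli.
have perM (n a : nat) : psi (a + f * n)%N%:Z = psi a%:Z.
  elim: n => [|n IH]; first by rewrite muln0 addn0.
  by rewrite mulnS addnCA PoszD addrC per.
elim: M => [|M IH] n.
  rewrite muln0 big_nil /fps_mul big1 // => i _.
  by rewrite fps_exp0 subrr mulr0.
have -> : (fun k => fps_exp (f * M.+1)%:R k - (k == 0%N)%:R) =
  (fun k => (fps_exp (f * M)%:R k - (k == 0%N)%:R) +
     fps_mul (fun k => fps_exp f%:R k - (k == 0%N)%:R) (fps_exp (f * M)%:R) k) :> (nat -> C).
  apply/funext => k; rewrite mulnS natrD -fps_expD /fps_mul.
  under [in RHS]eq_bigr do rewrite mulrBl.
  rewrite sumrB [X in _ = _ + (_ - X)]big_ord_recl /= mul1r subn0.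
  rewrite -mulr_sumr mul0r addr0.
  by rewrite addrAC subrKC.
rewrite fps_mulDr IH -fps_mulA.
have -> : fps_mul (fun k => B k / k`!%:R) (fun k => fps_exp f%:R k - (k == 0%N)%:R) =
  (fun k => \sum_(1 <= a < f.+1) psi a%:Z * fps_mul (fun k => (k == 1%N)%:R) (fps_exp a%:R) k).
  by apply/funext => k; exact: hB.
rewrite fps_mul_suml mulnSr -addSn [RHS](big_cat_nat (n := (f * M).+1)) //=; last first.
  by rewrite addSn ltnS leq_addr.
congr (_ + _); rewrite -[X in _ = \sum_(X <= _ < _) _]add1n big_addn.
have -> : ((f * M).+1 + f - f * M = f.+1)%N by lia.
apply: eq_bigr => a _.
by rewrite perM fps_mulA fps_expD natrD.
Qed.

(** Compares coefficients of t^(k+1): the factor t shifts the index on one side, and on the other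
    the term i = k + 1 drops out because e^(Nt) - 1 has no constant term. *)
Lemma bernoulli_power_sum N (psi : int -> C) B k : gen_bernoulli N psi B ->
  \sum_(1 <= a < N.+1) psi a%:Z * a%:R ^+ k =
  \sum_(i < k.+1) k`!%:R * (B i / i`!%:R / (k.+1 - i)`!%:R) * N%:R ^+ (k.+1 - i).
Proof.
move=> /(_ k.+1); under [X in _ = X]eq_bigr do rewrite fps_mulXS /fps_exp mulrA.
rewrite -mulr_suml /fps_mul big_ord_recr /= subnn /fps_exp expr0 fact0 divr1 subrr mulr0 addr0.
move=> /(congr1 ( *%R^~ k`!%:R)); rewrite divfK // => <-; rewrite mulr_suml; apply: eq_bigr => i _.
have -> : (k.+1 - i == 0)%N = false by rewrite subn_eq0 leqNgt ltn_ord.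
by rewrite subr0; field; rewrite !char0.
Qed.

End FormalPowerSeries.

Section BernoulliLimit.
Context (R : realType) (p : nat) (C : fieldType) (nrm : C -> R)
  (hC : is_Cp p nrm) (p_prime : prime p) (p_gt2 : (2 < p)%N).
Local Notation q := (p%:R^-1 : R).
Local Notation cvgC := (cvgC nrm).

(** For n >= r the power sum formula applies with N = p^n. After division by p^n only the term i = k
    is free of positive powers of p^n, and its coefficient is B k. *)
Lemma bernoulli_limit r (psi : int -> C) B k :
  (forall a, psi (a + (p ^ r)%N%:Z) = psi a) -> gen_bernoulli (p ^ r) psi B ->
  cvgC (fun n => p%:R ^- n * \sum_(1 <= a < (p ^ n).+1) psi a%:Z * a%:R ^+ k) (B k).
Proof.
move=> per hB.
have char0 := fact_neq0 hC p_prime p_gt2.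
pose c i : C := k`!%:R * (B i / i`!%:R / (k.+1 - i)`!%:R).
apply: (@cvgC_near _ _ _ _ hC (fun n => \sum_(i < k.+1) c i * (p%:R ^+ n) ^+ (k - i)) _ _ r).
  move=> n rn; have -> : (p ^ n = p ^ r * p ^ (n - r))%N by rewrite -expnD subnKC.
  rewrite (bernoulli_power_sum char0 _ (gen_bernoulli_multiple char0 _ per hB)).
  rewrite -expnD subnKC // natrX mulr_sumr; apply: eq_bigr => i _.
  rewrite mulrCA; congr (_ * _); rewrite subSn -1?ltnS // exprS mulrA mulVf ?mul1r //.
  exact: (pX_neq0 hC p_prime).
have -> : B k = \sum_(i < k.+1) c i * 0 ^+ (k - i).
  rewrite big_ord_recr /= subnn expr0 mulr1 big1 => [|i _]; last first.
    by rewrite expr0n subn_eq0 leqNgt ltn_ord mulr0.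
  by rewrite add0r /c subSnn factS fact0 muln1 divr1 mulrC divfK.
apply: (cvgC_sum hC) => i _; apply: (cvgCZ hC); apply: (cvgCX hC).
exact: (cvgC_pX hC p_prime p_gt2).
Qed.

End BernoulliLimit.

(** * Sums over residues modulo p^n *)

Section Sums.
Context (R : realType) (p : nat) (C : fieldType) (nrm : C -> R)
  (hC : is_Cp p nrm) (p_prime : prime p) (p_gt2 : (2 < p)%N).
Local Notation q := (p%:R^-1 : R).
Local Notation cvgC := (cvgC nrm).

Lemma sum_block (V : nmodType) (f : nat -> V) N M :
  \sum_(0 <= a < N * M) f a = \sum_(0 <= j < M) \sum_(0 <= a < N) f (a + N * j)%N.
Proof.
elim: M => [|M IH]; first by rewrite muln0 !big_nil.
rewrite big_nat_recr //= -IH mulnSr (big_cat_nat (n := (N * M)%N)) ?leq_addr //=.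
congr (_ + _); rewrite -[X in \sum_(X <= _ < _) _]add0n big_addn addKn.
by apply: eq_bigr.
Qed.

(** Extension by zero makes the sums range over the full interval from 0 to p^n - 1, which splits
    into blocks. *)
Definition off_p (F : nat -> C) a := if (p %| a)%N then 0 else F a.

Lemma sum_off_p F n : (0 < n)%N ->
  \sum_(1 <= a < (p ^ n).+1 | ~~ (p %| a)%N) F a = \sum_(0 <= a < p ^ n) off_p F a.
Proof.
move=> n0; rewrite [RHS](eq_bigr (fun a => if ~~ (p %| a)%N then F a else 0)); last first.
  by move=> a _; rewrite /off_p; case: ifP.
have p0 : (0 < p ^ n)%N by rewrite expn_gt0 prime_gt0.
rewrite -big_mkcond /= [RHS]big_ltn_cond // dvdn0 /=.
by rewrite big_mkcond big_nat_recr //= dvdn_exp //= addr0 -big_mkcond.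
Qed.

Lemma off_pP F n a j : (0 < n)%N -> off_p F (a + p ^ n * j) - off_p F a =
  if (p %| a)%N then 0 else F (a + p ^ n * j)%N - F a.
Proof.
move=> n0; rewrite /off_p dvdn_addl ?dvdn_mulr ?dvdn_exp //.
by case: ifP => // _; rewrite subr0.
Qed.

(** Writing residues modulo p^(n+1) as a + p^n j measures the change from level n to level n + 1.
    The weight is 1 for Volkenborn sums and (-1)^a / 2 for the alternating measure. *)
Lemma block_diff (w f : nat -> C) n :
  \sum_(0 <= a < p ^ n.+1) w a * f a - \sum_(0 <= j < p) \sum_(0 <= a < p ^ n) w (a + p ^ n * j)%N * f a =
  \sum_(0 <= j < p) \sum_(0 <= a < p ^ n) w (a + p ^ n * j)%N * (f (a + p ^ n * j)%N - f a).
Proof.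
rewrite expnSr sum_block -sumrB; apply: eq_bigr => j _.
by rewrite -sumrB; apply: eq_bigr => a _; rewrite mulrBr.
Qed.

(* Volkenborn-type bound: the sum over [p ^ n.+1] terms is, up to the Lipschitz
   error, [p] times the sum over [p ^ n] terms. *)
Lemma lip_sum_bound (f : nat -> C) M (D : R) : 0 <= D ->
  (forall a, nrm (f a) <= D * q ^+ M) ->
  (forall n a j, (M <= n)%N -> nrm (f (a + p ^ n * j)%N - f a) <= D * q ^+ n.+1) ->
  forall n, (M <= n)%N -> nrm (\sum_(0 <= a < p ^ n) f a) <= D * q ^+ n.
Proof.
move=> D0 fb fl n Mn; rewrite -(subnKC Mn); elim: (n - M)%N => [|k IH].
  by rewrite addn0; apply: (nrm_sum hC) => //; rewrite mulr_ge0 // (qX_ge0 R p_prime).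
rewrite addnS; set m := (M + k)%N in IH *.
have h := block_diff (fun=> 1) f m.
have -> : \sum_(0 <= a < p ^ m.+1) f a = \sum_(0 <= a < p ^ m.+1) 1 * f a.
  by apply: eq_bigr => a _; rewrite mul1r.
rewrite (canRL (subrK _) h); apply: (nrmD_le hC).
  apply: (nrm_sum hC) => [|j _]; first by rewrite mulr_ge0 // (qX_ge0 R p_prime).
  apply: (nrm_sum hC) => [|a _]; first by rewrite mulr_ge0 // (qX_ge0 R p_prime).
  by rewrite mul1r fl // leq_addr.
under eq_bigr do under eq_bigr do rewrite mul1r.
rewrite sumr_const_nat subn0 -[X in nrm X]mulr_natl (nrmM hC) (nrm_p hC) exprS mulrCA.
by rewrite ler_wpM2l // ltW // q_gt0.
Qed.

Lemma cvgC_shiftn u l M : cvgC (fun n => u (n + M)%N) l -> cvgC u l.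
Proof.
elim: M u => [|M IH] u h; first by move: h; under eq_fun do rewrite addn0.
apply: (cvgC_shift_inv hC); apply: (IH (fun n => u n.+1)).
by under eq_fun do rewrite -addnS.
Qed.

Lemma alternating_sum n : odd n -> \sum_(0 <= j < n) (-1) ^+ j = 1 :> C.
Proof.
move=> on; rewrite -(odd_double_half n) on add1n -addnn.
elim: (n./2) => [|k IH]; first by rewrite big_nat1.
by rewrite -[(_ + _).+1]/(k + k.+1).+2 addnS big_nat_recr //= big_nat_recr //= IH !exprS; ring.
Qed.

Lemma odd_p : odd p.
Proof. by case/even_prime: p_prime p_gt2 => [->|]. Qed.

Lemma nrm_half : nrm (2%:R^-1) = 1.
Proof.
rewrite (nrmV hC) (nrm_nat_unit hC p_prime p_gt2) ?invr1 //.
by apply/negP => /dvdn_leq; lia.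
Qed.

(* [(-1)^a / 2] defines a measure on Z_p, because [p] is odd. *)
Lemma alternating_cvg (f : nat -> C) M :
  (forall n a j, (M <= n)%N -> nrm (f (a + p ^ n * j)%N - f a) <= q ^+ n) ->
  exists l, cvgC (fun n => \sum_(0 <= a < p ^ n) (-1) ^+ a / 2%:R * f a) l.
Proof.
move=> fl; pose u n := \sum_(0 <= a < p ^ n) (-1) ^+ a / 2%:R * f a.
have [|l hl _] := cvg_rate hC (u := fun n => u (n + M)%N) (rate_q R p_prime p_gt2).
  move=> n; rewrite addSn; set m := (n + M)%N.
  have h := block_diff (fun a => (-1) ^+ a / 2%:R) f m.
  (* Additivity of the measure: p^m is odd, so the p lifts of a carry the signs (-1)^a (-1)^j, and
     the sum of (-1)^j over j < p is 1. *)
  suff e : u m = \sum_(0 <= j < p) \sum_(0 <= a < p ^ m) (-1) ^+ (a + p ^ m * j) / 2%:R * f a.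
    rewrite {1}/u e h.
    apply: (nrm_sum hC) => [|j _]; first by rewrite (qX_ge0 R p_prime).
    apply: (nrm_sum hC) => [|a _]; first by rewrite (qX_ge0 R p_prime).
    rewrite (nrmM hC) (nrmM hC) (nrm_sign hC) nrm_half !mul1r.
    by apply: le_trans (fl _ _ _ (leq_addl _ _)) _; apply: (ler_qX R p_prime p_gt2); exact: leq_addr.
  rewrite /u -[LHS]mul1r -[X in X * _](alternating_sum odd_p) mulr_suml; apply: eq_bigr => j _.
  rewrite mulr_sumr; apply: eq_bigr => a _.
  rewrite exprD !mulrA; congr (_ * _ * _); rewrite [RHS]mulrC; congr (_ * _).
  by rewrite exprM -[(-1) ^+ (p ^ m)]signr_odd oddX odd_p orbT expr1.
by exists l; exact: cvgC_shiftn hl.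
Qed.

End Sums.

(** * Power series converging on Z_p *)

Section TateSeries.
Local Open Scope classical_set_scope.
Local Open Scope ring_scope.
Context (R : realType) (p : nat) (C : fieldType) (nrm : C -> R)
  (hC : is_Cp p nrm) (p_prime : prime p) (p_gt2 : (2 < p)%N).
Local Notation q := (p%:R^-1 : R).
Local Notation cvgC := (cvgC nrm).
Local Notation in_Zp := (in_Zp nrm).

(** A bound on the Gauss norm, which controls both the values and the Lipschitz constant of P on the
    closed unit disc. *)
Definition gauss_le (P : {poly C}) (e : R) := forall i, nrm P`_i <= e.

Lemma gauss_leM P Q a b : 0 <= a -> 0 <= b ->
  gauss_le P a -> gauss_le Q b -> gauss_le (P * Q) (a * b).
Proof.
move=> a0 b0 hP hQ i; rewrite coefM; apply: (nrm_sum hC) => [|j _]; first exact: mulr_ge0.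
exact: (nrmM_le hC).
Qed.

Lemma gauss_leZ c P a e : nrm c <= a -> gauss_le P e -> gauss_le (c *: P) (a * e).
Proof. by move=> hc hP i; rewrite coefZ; exact: (nrmM_le hC). Qed.

Lemma gauss_le_linear c : nrm c <= 1 -> gauss_le (c%:P - 'X) 1.
Proof.
move=> hc i; rewrite coefB coefC coefX; apply: (nrmB_le hC); last exact: nrm_nat hC _.
by case: ifP => // _; rewrite (nrm0 hC).
Qed.

Lemma gauss_le_prod (I : Type) (r : seq I) (F : I -> {poly C}) :
  (forall i, gauss_le (F i) 1) -> gauss_le (\prod_(i <- r) F i) 1.
Proof.
move=> h; elim: r => [|i r IH].
  rewrite big_nil => i; rewrite coef1; exact: nrm_nat hC _.
by rewrite big_cons; have := gauss_leM ler01 ler01 (h i) IH; rewrite mulr1.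
Qed.

Lemma gauss_le_horner P e s : 0 <= e -> gauss_le P e -> nrm s <= 1 -> nrm P.[s] <= e.
Proof.
move=> e0 hP hs; rewrite horner_coef; apply: (nrm_sum hC) => // i _.
by apply: (nrmM_le1r hC) => //; exact: (nrmX_le1 hC).
Qed.

Lemma gauss_le_lip P e s t : 0 <= e -> gauss_le P e -> nrm s <= 1 -> nrm t <= 1 ->
  nrm (P.[s] - P.[t]) <= e * nrm (s - t).
Proof.
move=> e0 hP hs ht; rewrite !horner_coef -sumrB.
apply: (nrm_sum hC) => [|i _]; first by rewrite mulr_ge0 ?(nrm_ge0 hC).
by rewrite -mulrBr; apply: (nrmM_le hC) => //; exact: (exprn_lip hC).
Qed.

(** Gauss norms tending to 0 make the series of polynomials converge coefficientwise, at a rate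
    uniform in the coefficient; this is what permits rearranging it into one power series. The rate
    [q ^+ j./2] is the one left by [fact_inv_bound]. *)
Lemma tate_series (P : nat -> {poly C}) (K : R) : 0 <= K ->
  (forall j, gauss_le (P j) (K * q ^+ j./2)) ->
  exists F : C -> C, [/\ analytic_on_Zp nrm F,
    forall s, in_Zp s -> cvgC (fun J => \sum_(0 <= j < J) (P j).[s]) (F s)
  & forall s t, in_Zp s -> in_Zp t -> nrm (F s - F t) <= K * nrm (s - t)].
Proof.
move=> K0 hP; pose r j := K * q ^+ j./2.
have r_rate : rate r by apply: rateZ => //; exact: rate_q_half.
have r0 j : 0 <= r j by rewrite mulr_ge0 // (qX_ge0 R p_prime).
have series (x : nat -> C) : (forall j, nrm (x j) <= r j) ->
    exists2 l, cvgC (fun J => \sum_(0 <= j < J) x j) l &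
      forall J, nrm (\sum_(0 <= j < J) x j - l) <= r J.
  by move=> hx; apply: (cvg_rate hC) => // J; rewrite big_nat_recr //= addrAC subrr add0r.
pose F s := xget 0 [set l | cvgC (fun J => \sum_(0 <= j < J) (P j).[s]) l].
have hF s : in_Zp s -> cvgC (fun J => \sum_(0 <= j < J) (P j).[s]) (F s) /\
    forall J, nrm (\sum_(0 <= j < J) (P j).[s] - F s) <= r J.
  move=> hs; have [|l hl far] := series (fun j => (P j).[s]).
    by move=> j; exact: (gauss_le_horner (r0 j) (hP j) (in_Zp_nrm hC hs)).
  have hFs : cvgC (fun J => \sum_(0 <= j < J) (P j).[s]) (F s).
    by apply: (@xgetPex _ 0 [set l | cvgC (fun J => \sum_(0 <= j < J) (P j).[s]) l]); exists l.
  by split => // J; rewrite (cvgC_unique hC hFs hl).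
exists F; split=> [|s hs|s t hs ht]; last 2 first.
- exact: (hF s hs).1.
- have cv := cvgCB hC (hF s hs).1 (hF t ht).1.
  apply: (cvgC_nrm_le hC cv); exists 0%N => J _.
  rewrite -sumrB; apply: (nrm_sum hC) => [|j _]; first by rewrite mulr_ge0 ?(nrm_ge0 hC).
  apply: gauss_le_lip; rewrite ?(in_Zp_nrm hC) // => i.
  apply: le_trans (hP j i) _; rewrite -[leRHS]mulr1 ler_wpM2l //.
  by apply: exprn_ile1; apply: ltW; rewrite ?q_gt0 ?q_lt1.
have /choice[c hc] : forall n, exists l, cvgC (fun J => \sum_(0 <= j < J) (P j)`_n) l /\
      forall J, nrm (\sum_(0 <= j < J) (P j)`_n - l) <= r J.
  by move=> n; have [|l h1 h2] := series (fun j => (P j)`_n); [move=> j; exact: hP|exists l].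
exists c => s hs; apply/(cvgCP hC) => e e0.
have [J hJ] := r_rate.2 _ e0.
(* The partial sum Q is within [r J] of F at s and, coefficient by coefficient, of the power series;
   beyond its size the truncation loses nothing of Q. *)
pose Q := \sum_(0 <= j < J) P j.
exists (size Q) => N sN; apply: le_lt_trans hJ.
have Qs : Q.[s] = \sum_(0 <= j < J) (P j).[s] by rewrite horner_sum.
apply: (nrm_dist_le hC (y := Q.[s])); last by rewrite Qs; exact: (hF s hs).2.
rewrite (horner_coef_wide _ sN) -sumrB; apply: (nrm_sum hC) => // i _.
rewrite -mulrBl; apply: (nrmM_le1r hC); first by apply: (nrmX_le1 hC); exact: (in_Zp_nrm hC hs).
by rewrite (nrm_distC hC) coef_sum; exact: (hc i).2.
Qed.

Lemma logn_fact_half n : (2 * logn p n`! <= n)%N.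
Proof.
rewrite logn_fact //.
(* The extra last term lets the induction on Legendre's sum close: as p >= 3, each quotient is at
   most a third of the preceding one. *)
suff h K : (2 * (\sum_(1 <= k < K.+1) n %/ p ^ k) + n %/ p ^ K <= n)%N.
  exact: leq_trans (leq_addr _ _) (h n).
elim: K => [|K IH]; first by rewrite big_nil expn0 divn1.
rewrite big_nat_recr //=.
have : (3 * (n %/ p ^ K.+1) <= n %/ p ^ K)%N.
  rewrite expnSr divnMA; apply: leq_trans (leq_trunc_div _ p); rewrite mulnC leq_mul2l p_gt2 orbT //.
lia.
Qed.

Lemma fact_inv_bound n : q ^+ n * nrm (n`!%:R^-1) <= q ^+ n./2.
Proof.
rewrite (nrmV hC) (nrm_natE hC p_prime p_gt2) ?fact_gt0 // ler_pdivrMr ?(qX_gt0 R p_prime) //.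
rewrite -exprD; apply: (ler_qX R p_prime p_gt2); have := logn_fact_half n; lia.
Qed.

End TateSeries.

(** * Volkenborn integrals *)

Section Volkenborn.
Local Open Scope classical_set_scope.
Local Open Scope ring_scope.
Context (R : realType) (p : nat) (C : fieldType) (nrm : C -> R)
  (hC : is_Cp p nrm) (p_prime : prime p) (p_gt2 : (2 < p)%N).
Local Notation q := (p%:R^-1 : R).
Local Notation cvgC := (cvgC nrm).
Local Notation in_Zp := (in_Zp nrm).
Local Notation omega := (omega nrm p).
Local Notation angle := (angle nrm p).
Local Notation padic_pow := (padic_pow nrm).

Definition volkenborn (F : nat -> C) n := p%:R ^- n * \sum_(0 <= a < p ^ n) off_p p F a.

Lemma eq_volkenborn F G n : (forall a, ~~ (p %| a)%N -> F a = G a) ->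
  volkenborn F n = volkenborn G n.
Proof.
move=> h; congr (_ * _); apply: eq_bigr => a _; rewrite /off_p.
by case: ifPn => // /h.
Qed.

Lemma volkenborn_sum N (c : nat -> C) (G : nat -> nat -> C) n :
  volkenborn (fun a => \sum_(i < N) c i * G i a) n = \sum_(i < N) c i * volkenborn (G i) n.
Proof.
rewrite /volkenborn (eq_bigr (fun a => \sum_(i < N) c i * off_p p (G i) a)).
  rewrite exchange_big /= mulr_sumr; apply: eq_bigr => i _.
  by rewrite -mulr_sumr mulrCA.
by move=> a _; rewrite /off_p; case: ifP => // _; rewrite big1 // => i _; rewrite mulr0.
Qed.

Lemma sum_multiples (F : nat -> C) N :
  \sum_(1 <= a < (p * N).+1 | (p %| a)%N) F a = \sum_(1 <= b < N.+1) F (p * b)%N.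
Proof.
rewrite big_add1 /= [RHS]big_add1 /= big_mkcond /= sum_block.
apply: eq_bigr => j _; rewrite -[X in \sum_(0 <= a < X) _](prednK (prime_gt0 p_prime)).
rewrite big_nat_recr //= big_nat_cond big1 => [|i /andP[/andP[_ ip] _]]; last first.
  rewrite -addSn dvdn_addl ?dvdn_mulr //; case: ifP => // /dvdn_leq; lia.
have -> : (p.-1 + p * j).+1 = (p * j.+1)%N by have := prime_gt0 p_prime; nia.
by rewrite dvdn_mulr // add0r.
Qed.

Lemma nat_p_int (a : nat) : ~~ (p %| a)%N -> ~~ (p%:Z %| a%:Z)%Z.
Proof. by rewrite dvdzE. Qed.

Context (chi : int -> C) (m : nat) (chi_dir : dirichlet_char (p ^ m) chi).
Local Notation M := (maxn m 1).
Local Notation psi k a := (chi (Posz a) * omega (Posz a) ^- k).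

Lemma chi_nrm (a : int) : ~~ (p%:Z %| a)%Z -> nrm (chi a) = 1.
Proof.
move=> pa; apply: (root_nrm hC (n := totient (p ^ m))).
  by rewrite totient_gt0 expn_gt0 prime_gt0.
by apply: dirichlet_root chi_dir _; exact: coprimez_pX.
Qed.

Lemma shift_unit n (a j : nat) : (M <= n)%N -> ~~ (p %| a)%N -> ~~ (p %| a + p ^ n * j)%N.
Proof.
by move=> Mn pa; rewrite dvdn_addl // dvdn_mulr // dvdn_exp // (leq_trans _ Mn) // leq_maxr.
Qed.

Lemma shift_dvd n k (a j : nat) : (k <= n)%N ->
  (p%:Z ^+ k %| (a + p ^ n * j)%N%:Z - a%:Z)%Z.
Proof.
move=> kn; rewrite PoszD addrC addKr dvdzE abszX /=.
by rewrite dvdn_mulr // dvdn_exp2l.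
Qed.

Lemma omega_shift n (a j : nat) : (M <= n)%N -> ~~ (p %| a)%N ->
  omega (a + p ^ n * j)%N = omega a.
Proof.
move=> Mn pa; apply: (omega_mod hC p_prime p_gt2).
- exact/nat_p_int/shift_unit.
- exact: nat_p_int.
- by rewrite -[p%:Z]expr1; apply: shift_dvd; rewrite (leq_trans _ Mn) // leq_maxr.
Qed.

Lemma psi_shift k n (a j : nat) : (M <= n)%N -> ~~ (p %| a)%N ->
  psi k (a + p ^ n * j)%N = psi k a.
Proof.
move=> Mn pa; rewrite omega_shift //; congr (_ * _).
apply: (dirichlet_mod chi_dir); rewrite (_ : (p ^ m)%N%:Z = p%:Z ^+ m); last by rewrite -!natz natrX.
apply: shift_dvd.
by rewrite (leq_trans _ Mn) // leq_maxl.
Qed.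

Lemma angle_shift n (a j : nat) : (M <= n)%N -> ~~ (p %| a)%N ->
  nrm (angle (a + p ^ n * j)%N - angle a) <= q ^+ n.
Proof.
move=> Mn pa; rewrite (angle_lip hC) //.
- rewrite -rmorphB; apply: (nrm_int_dvd hC); exact: shift_dvd.
- exact/nat_p_int/shift_unit.
- by rewrite -[p%:Z]expr1; apply: shift_dvd; rewrite (leq_trans _ Mn) // leq_maxr.
Qed.

Lemma psi_nrm k (a : nat) : ~~ (p %| a)%N -> nrm (psi k a) = 1.
Proof.
move=> /nat_p_int pa; rewrite (nrm_div hC) chi_nrm // (nrmX hC) (omega_nrm hC) //.
by rewrite expr1n divr1.
Qed.

(** Passes from the integrand continuous in k to the power sums of chi omega^-k, for which Bernoulli
    numbers are available. *)
Lemma chi_angleX k (a : nat) : ~~ (p %| a)%N -> chi a * angle a ^+ k = psi k a * a%:R ^+ k.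
Proof.
move=> /nat_p_int pa; have w0 := omega_neq0 hC p_prime p_gt2 pa.
rewrite pmulrn (angleE hC p_prime p_gt2 pa) [(angle a * _) ^+ k]exprMn -mulrA; congr (_ * _).
by rewrite mulrCA mulVf ?mulr1 // expf_neq0.
Qed.

(** The Euler factor arises by removing the multiples of p: substituting a = p b turns their sum at
    level n + 1 into a multiple of the full sum at level n. The factor p^(k-1) is written
    [p%:R ^+ k / p%:R] so that k = 0, which gives F(1), is included. *)
Lemma volkenborn_bernoulli k f B : primitive_char f (twist nrm p chi k) ->
  gen_bernoulli f (twist nrm p chi k) B ->
  cvgC (volkenborn (fun a => chi a * angle a ^+ k))
    ((1 - twist nrm p chi k p%:Z * (p%:R ^+ k / p%:R)) * B k).
Proof.
have [_ agree] := twistP hC p_prime p_gt2 k chi_dir.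
set tw := twist nrm p chi k in agree * => prim hB.
have [r fr] : exists r, f = (p ^ r)%N.
  apply: (dirichlet_coprime_p p_prime prim.1) => a pa; rewrite agree // mulf_neq0 //.
    by case: chi_dir => _ _ _ ->; exact: coprimez_pX.
  by rewrite invr_eq0 expf_neq0 // (omega_neq0 hC).
subst f; case: (prim.1) => _ mul per _.
have lim := bernoulli_limit hC p_prime p_gt2 k per hB.
set A := (fun n => _) in lim.
apply: (cvgC_shift_inv hC).
rewrite mulrBl mul1r.
have e n : volkenborn (fun a => chi a * angle a ^+ k) n.+1 =
    A n.+1 - tw p%:Z * (p%:R ^+ k / p%:R) * A n.
  rewrite /A (bigID (fun a => (p %| a)%N)) /= expnS sum_multiples -expnS mulrDr.
  rewrite (sum_off_p p_prime) //.
  have -> : p%:R ^- n.+1 * \sum_(0 <= a < p ^ n.+1) off_p p (fun a : nat => tw a * a%:R ^+ k) a =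
      volkenborn (fun a => chi a * angle a ^+ k) n.+1.
    congr (_ * _); apply: eq_bigr => a _; rewrite /off_p; case: ifPn => // pa.
    by rewrite (agree _ (nat_p_int pa)); apply/esym/chi_angleX.
  suff -> : p%:R ^- n.+1 * \sum_(1 <= b < (p ^ n).+1) tw (p * b)%N * (p * b)%:R ^+ k =
     tw p%:Z * (p%:R ^+ k / p%:R) * (p%:R ^- n * \sum_(1 <= a < (p ^ n).+1) tw a * a%:R ^+ k).
    by rewrite [X in X - _]addrC addrK.
  rewrite !mulr_sumr; apply: eq_bigr => b _.
  rewrite PoszM mul natrM exprMn exprS; field.
  by rewrite (pX_neq0 hC p_prime) (p_neq0 hC p_prime).
under eq_fun do rewrite e.
by apply: (cvgCB hC); [exact: (cvgC_shift hC lim)|exact: (cvgCZ hC)].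
Qed.

Lemma volkenborn_cvg k : exists V, cvgC (volkenborn (fun a => chi a * angle a ^+ k)) V.
Proof.
have [[r prim] _] := twistP hC p_prime p_gt2 k chi_dir.
have [|B hB] := gen_bernoulli_exists (fact_neq0 hC p_prime p_gt2) (f := p ^ r) (twist nrm p chi k).
  by rewrite natrX (pX_neq0 hC).
by eexists; exact: volkenborn_bernoulli prim hB.
Qed.

Lemma near0_lip x y j : nrm x <= q -> nrm y <= q ->
  nrm (x ^+ j.+1 - y ^+ j.+1) <= q ^+ j * nrm (x - y).
Proof.
move=> hx hy; elim: j => [|j IH]; first by rewrite !expr1 expr0 mul1r.
have -> : x ^+ j.+2 - y ^+ j.+2 = x * (x ^+ j.+1 - y ^+ j.+1) + (x - y) * y ^+ j.+1.
  by rewrite ![_ ^+ j.+2]exprS; ring.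
apply: (nrmD_le hC); first by rewrite [q ^+ _]exprS -mulrA; apply: (nrmM_le hC).
rewrite mulrC; apply: (nrmM_le hC) => //; rewrite (nrmX hC).
by rewrite lerXn2r ?nnegrE ?(nrm_ge0 hC) ?(ltW (q_gt0 R p_prime)).
Qed.

Local Notation K := ((q ^+ M.+2)^-1).

Lemma K_ge0 : 0 <= K.
Proof. by rewrite invr_ge0 (qX_ge0 R p_prime). Qed.

(** The integrand is at most q^j, and by [near0_lip] its variation gains a factor q^(j-1) for j > 0,
    so that [lip_sum_bound] applies with D = K q^j. In K = p^(M+2), p^M pays for the starting level
    M and p^2 for the two index shifts; what matters is that K does not depend on j. *)
Lemma mahler_bound j W :
  cvgC (volkenborn (fun a => chi a * (angle a - 1) ^+ j)) W -> nrm W <= K * q ^+ j.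
Proof.
move=> /(cvgC_nrm_le hC); apply; exists M => n Mn.
rewrite /volkenborn (nrmM hC) (nrmV hC) (nrm_pX hC) mulrC ler_pdivrMr ?(qX_gt0 R p_prime) //.
have qM : q ^+ M.+2 != 0 by rewrite gt_eqF // (qX_gt0 R p_prime).
have D0 : 0 <= K * q ^+ j by rewrite mulr_ge0 ?K_ge0 ?(qX_ge0 R p_prime).
have M0 i : (M <= i)%N -> (0 < i)%N by apply: leq_trans; exact: leq_maxr.
apply: (lip_sum_bound hC (M := M) (D := K * q ^+ j) (f := off_p p (fun a : nat => chi a * (angle a - 1) ^+ j))) => // [a|i a b Mi].
  apply: (@le_trans _ _ (q ^+ j)).
    rewrite /off_p; case: ifPn => [_|pa]; first by rewrite (nrm0 hC) (qX_ge0 R p_prime).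
    rewrite (nrmM hC) (chi_nrm (nat_p_int pa)) mul1r (nrmX hC).
    by rewrite lerXn2r ?nnegrE ?(nrm_ge0 hC) ?(ltW (q_gt0 R p_prime)) // // (angle_near1 hC p_prime p_gt2 (nat_p_int pa)).
  rewrite mulrAC -[leLHS]mul1r ler_wpM2r ?(qX_ge0 R p_prime) //.
  rewrite mulrC ler_pdivlMr ?(qX_gt0 R p_prime) // mul1r.
  by apply: ler_qX => //; lia.
rewrite off_pP ?M0 //; case: ifPn => [_|pa]; first by rewrite (nrm0 hC) mulr_ge0 // (qX_ge0 R p_prime).
have := psi_shift 0 b Mi pa; rewrite !expr0 invr1 !mulr1 => ->.
rewrite -mulrBr (nrmM hC) (chi_nrm (nat_p_int pa)) mul1r.
case: j D0 => [|j] D0; first by rewrite subrr (nrm0 hC) mulr_ge0 // (qX_ge0 R p_prime).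
have pa' := shift_unit b Mi pa.
apply: le_trans (near0_lip _ (angle_near1 hC p_prime p_gt2 (nat_p_int pa'))
  (angle_near1 hC p_prime p_gt2 (nat_p_int pa))) _.
rewrite opprB addrA subrK -mulrA mulrC ler_pdivlMl ?(qX_gt0 R p_prime) // mulrC.
apply: (@le_trans _ _ (q ^+ i * q ^+ j * q ^+ M.+2)).
  rewrite [leLHS]mulrC ler_wpM2r ?(qX_ge0 R p_prime) // mulrC.
  by rewrite ler_wpM2r ?(qX_ge0 R p_prime) // angle_shift.
by rewrite -!exprD; apply: ler_qX => //; lia.
Qed.

(* [W j], the Volkenborn integral of [chi (<a> - 1)^j], is the j-th Mahler
   coefficient of [V]; its decay makes the Mahler series a power series. *)
Lemma volkenborn_mahler : exists V W : nat -> C, [/\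
  forall k, cvgC (volkenborn (fun a => chi a * angle a ^+ k)) (V k),
  forall j, nrm (W j) <= K * q ^+ j
  & forall k, V k = \sum_(j < k.+1) 'C(k, j)%:R * W j].
Proof.
have [V hV] := choice volkenborn_cvg.
(* Binomial expansion of (<a> - 1)^j reduces convergence to that of the integrals V i; the converse
   expansion of <a>^k gives the last clause. *)
have exW j : exists W, cvgC (volkenborn (fun a => chi a * (angle a - 1) ^+ j)) W.
  exists (\sum_(i < j.+1) ((-1) ^+ (j - i) *+ 'C(j, i)) * V i).
  apply: (@cvgC_near _ _ _ _ hC (fun n => \sum_(i < j.+1) ((-1) ^+ (j - i) *+ 'C(j, i)) *
     volkenborn (fun a => chi a * angle a ^+ i) n) _ _ 0).
    move=> n _; rewrite -(volkenborn_sum _ (fun i => (-1) ^+ (j - i) *+ 'C(j, i)) (fun i a => chi a * angle a ^+ i)).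
    apply: eq_volkenborn => a _; rewrite [angle a - 1]addrC exprDn mulr_sumr.
    by apply: eq_bigr => i _; rewrite mulrCA -mulrnAl.
  by apply: (cvgC_sum hC) => i _; apply: (cvgCZ hC).
have [W hW] := choice exW.
exists V, W; split=> // [j|k]; first exact: mahler_bound.
apply: (cvgC_unique hC (hV k)).
apply: (@cvgC_near _ _ _ _ hC (fun n => \sum_(j < k.+1) 'C(k, j)%:R *
     volkenborn (fun a => chi a * (angle a - 1) ^+ j) n) _ _ 0).
  move=> n _; rewrite -(volkenborn_sum _ (fun j => 'C(k, j)%:R) (fun j a => chi a * (angle a - 1) ^+ j)).
  apply: eq_volkenborn => a _; rewrite -{2}(subrK 1 (angle a)) [_ + 1]addrC exprDn mulr_sumr.
  by apply: eq_bigr => i _; rewrite expr1n mul1r mulrCA mulr_natl.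
by apply: (cvgC_sum hC) => i _; apply: (cvgCZ hC).
Qed.

End Volkenborn.

(** * The p-adic L-function *)

Section Interpolation.
Local Open Scope classical_set_scope.
Local Open Scope ring_scope.
Context (R : realType) (p : nat) (C : fieldType) (nrm : C -> R)
  (hC : is_Cp p nrm) (p_prime : prime p) (p_gt2 : (2 < p)%N).
Local Notation q := (p%:R^-1 : R).
Local Notation cvgC := (cvgC nrm).
Local Notation in_Zp := (in_Zp nrm).
Local Notation omega := (omega nrm p).
Local Notation angle := (angle nrm p).

(* The binomial coefficient [binom (1 - s, j)] as a polynomial in [s], and its
   quotient by [s - 1] for positive index. *)
Definition binom1B j : {poly C} :=
  (j`!%:R)^-1 *: \prod_(0 <= i < j) ((1 - i%:R)%:P - 'X).
Definition binom1B_div j : {poly C} :=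
  (- (j.+1)`!%:R^-1) *: \prod_(0 <= i < j) ((1 - i.+1%:R)%:P - 'X).

Lemma binom1BS j s : (binom1B j.+1).[s] = (s - 1) * (binom1B_div j).[s].
Proof.
rewrite /binom1B /binom1B_div !hornerZ big_nat_recl //; set Q := \prod_(0 <= i < j) _.
rewrite hornerM; have -> : ((1 - 0%:R)%:P - 'X).[s] = 1 - s by rewrite !hornerE subr0.
ring.
Qed.

Lemma binom1B_nat j k : (binom1B j).[1 - k%:R] = 'C(k, j)%:R.
Proof.
have -> : (binom1B j).[1 - k%:R] = (j`!%:R)^-1 * (k ^_ j)%:R.
  rewrite hornerZ; congr (_ * _); elim: j => [|j IH]; first by rewrite big_nil hornerE.
  rewrite big_nat_recr //= hornerM IH ffactnSr natrM !hornerE.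
  have [jk|kj] := leqP j k; first by rewrite natrB //; ring.
  by rewrite ffact_small // !mul0r.
rewrite -bin_ffact natrM mulrCA mulVf ?mulr1 //.
exact: (fact_neq0 hC).
Qed.

Lemma nrm_1Bnat i : nrm (1 - i%:R) <= 1.
Proof. by apply: (nrmB_le hC); rewrite ?(nrm_nat hC) // (nrm1 hC). Qed.

Lemma gauss_binom1B (K : R) j c : 0 <= K -> nrm c <= K * q ^+ j ->
  gauss_le nrm (c *: binom1B j) (K * q ^+ j./2).
Proof.
move=> K0 hc; have hb : K * q ^+ j * nrm (j`!%:R^-1) * 1 <= K * q ^+ j./2.
  by rewrite mulr1 -mulrA ler_wpM2l // (fact_inv_bound hC).
move=> i; apply: le_trans hb; move: i; rewrite /binom1B scalerA.
apply: (gauss_leZ hC); first exact: (nrmM_le hC).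
by apply: (gauss_le_prod hC) => i; apply: (gauss_le_linear hC); exact: nrm_1Bnat.
Qed.

Lemma gauss_binom1B_div (K : R) j c : 0 <= K -> nrm c <= K * q ^+ j.+1 ->
  gauss_le nrm (c *: binom1B_div j) (K * q ^+ j./2).
Proof.
move=> K0 hc; have hb : K * q ^+ j.+1 * nrm (- (j.+1)`!%:R^-1) * 1 <= K * q ^+ j./2.
  rewrite mulr1 -mulrA ler_wpM2l // (nrmN hC).
  apply: le_trans (fact_inv_bound hC p_prime p_gt2 _) _.
  by apply: (ler_qX R p_prime p_gt2); apply: half_leq.
move=> i; apply: le_trans hb; move: i; rewrite /binom1B_div scalerA.
apply: (gauss_leZ hC); first exact: (nrmM_le hC).
by apply: (gauss_le_prod hC) => i; apply: (gauss_le_linear hC); exact: nrm_1Bnat.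
Qed.

Context (chi : int -> C) (m : nat) (chi_dir : dirichlet_char (p ^ m) chi).
Local Notation volk k := (volkenborn p (fun a : nat => chi a * angle a ^+ k)).

Lemma numerator_exists : exists F : C -> C, [/\ analytic_on_Zp nrm F,
  exists K : R, 0 <= K /\ forall s t, in_Zp s -> in_Zp t -> nrm (F s - F t) <= K * nrm (s - t),
  forall k, cvgC (volk k) (F (1 - k%:R))
  & F 1 = 0 -> exists2 G, analytic_on_Zp nrm G & forall s, in_Zp s -> F s = (s - 1) * G s].
Proof.
have [V [W [hV hW VW]]] := volkenborn_mahler hC p_prime p_gt2 chi_dir.
set K := _^-1 in hW.
have K0 : 0 <= K by rewrite invr_ge0 (qX_ge0 R p_prime).
have [F [anF cvF lipF]] := tate_series hC p_prime p_gt2 K0 (fun j => gauss_binom1B K0 (hW j)).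
have FV k : F (1 - k%:R) = V k.
  apply: (cvgC_unique hC (cvF _ _)); first exact/(in_ZpB hC)/in_Zp_nat/hC/(in_Zp_nat hC 1).
  (* At 1 - k the Mahler series is finite: 'C(k, j) vanishes for j > k. *)
  apply: (@cvgC_near _ _ _ _ hC (fun=> V k) _ _ k.+1); last exact: (cvgC_cst hC).
  move=> J kJ; rewrite VW -(subnKC kJ) [RHS](big_cat_nat (n := k.+1)) ?leq_addr //=.
  rewrite [X in _ = _ + X]big_nat_cond [X in _ = _ + X]big1 ?addr0 => [|j /andP[/andP[kj _] _]]; last first.
    by rewrite hornerZ binom1B_nat bin_small ?mulr0.
  by rewrite big_mkord; apply: eq_bigr => j _; rewrite hornerZ binom1B_nat mulrC.
exists F; split=> //; first by exists K.
  by move=> k; rewrite FV.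
move=> F1; have W0 : W 0%N = 0.
  by have := VW 0%N; rewrite big_ord1 bin0 mul1r -FV subr0 F1 => <-.
have [G [anG cvG _]] := tate_series hC p_prime p_gt2 K0 (fun j => gauss_binom1B_div K0 (hW j.+1)).
exists G => // s hs; apply: (cvgC_unique hC (cvgC_shift hC (cvF s hs))).
apply: (@cvgC_near _ _ _ _ hC _ _ _ 0 _ (cvgCZ hC (s - 1) (cvG s hs))) => J _.
rewrite [RHS]big_nat_recl // W0 scale0r horner0 add0r mulr_sumr.
by apply: eq_bigr => j _; rewrite hornerZ [RHS]hornerZ binom1BS mulrCA.
Qed.

Lemma continuous_cvg (L : C -> C) (t : nat -> C) s : continuous_on_Zp_minus1 nrm L ->
  in_Zp s -> s != 1 -> (forall n, in_Zp (t n)) -> (forall n, t n != 1) ->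
  cvgC t s -> cvgC (fun n => L (t n)) (L s).
Proof.
move=> cL hs s1 ht t1 /(cvgCP hC) ts; apply/(cvgCP hC) => e e0.
have [d d0 hd] := cL s hs s1 e e0; have [N hN] := ts d d0.
by exists N => n Nn; apply: hd => //; exact: hN.
Qed.

Lemma continuous_div_sub1 (F : C -> C) (K : R) : 0 <= K ->
  (forall s t, in_Zp s -> in_Zp t -> nrm (F s - F t) <= K * nrm (s - t)) ->
  continuous_on_Zp_minus1 nrm (fun s => F s / (s - 1)).
Proof.
move=> K0 lip s hs s1 e e0.
have s10 : s - 1 != 0 by rewrite subr_eq0.
set c := nrm (s - 1); have c0 : 0 < c by exact: (nrm_gt0 hC).
set B := K + nrm (F s) + 1.
have B0 : 0 < B by rewrite ltr_wpDl // addr_ge0 // (nrm_ge0 hC).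
(* Closer than c to s, the point t keeps the distance c from 1, so the common denominator has norm c
   * c; the numerator is at most B |t - s|. The summand 1 keeps B positive. *)
exists (Num.min c (e * (c * c) / B)).
  by rewrite lt_min c0 /= divr_gt0 // mulr_gt0 // mulr_gt0.
move=> t ht t1; rewrite lt_min => /andP[tc te].
have t10 : t - 1 != 0 by rewrite subr_eq0.
have ct : nrm (t - 1) = c.
  by apply: (nrm_close hC); rewrite opprB addrA subrK.
have -> : F t / (t - 1) - F s / (s - 1) =
  ((F t - F s) * (s - 1) - F s * (t - s)) / ((t - 1) * (s - 1)) by field; rewrite t10 s10.
rewrite (nrm_div hC) (nrmM hC (t - 1)) ct -/c ltr_pdivrMr ?mulr_gt0 //.
move: te; rewrite ltr_pdivlMr // mulrC; apply: le_lt_trans.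
have c1 : nrm (s - 1) <= 1 by apply/(in_Zp_nrm hC)/(in_ZpB hC) => //; exact: (in_Zp_nat hC 1).
apply: (nrmB_le hC).
  apply: (nrmM_le1r hC) => //; apply: le_trans (lip _ _ ht hs) _.
  by rewrite ler_wpM2r ?(nrm_ge0 hC) // /B -addrA lerDl addr_ge0 ?(nrm_ge0 hC).
rewrite (nrmM hC) ler_wpM2r ?(nrm_ge0 hC) // /B; rewrite addrAC lerDr addr_ge0 //.
Qed.

Lemma Lp_unique (L : C -> C) : continuous_on_Zp_minus1 nrm L -> interpolates nrm p chi L ->
  forall s, in_Zp s -> s != 1 -> Lp nrm p chi s = L s.
Proof.
move=> cL iL s hs s1.
have [cL' iL'] : [set L : C -> C |
    continuous_on_Zp_minus1 nrm L /\ interpolates nrm p chi L] (Lp nrm p chi).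
  by apply: xgetPex; exists L.
have [u u1 hu] := in_Zp_cvg_1B hC p_prime p_gt2 1 hs.
have uZ n : in_Zp (1 - (u n)%:R) by apply/(in_ZpB hC)/in_Zp_nat/hC/(in_Zp_nat hC 1).
have un1 n : 1 - (u n)%:R != 1 :> C.
  rewrite -subr_eq0 (_ : _ - 1 = - (u n)%:R); last by ring.
  by rewrite oppr_eq0 (natr_neq0 hC p_prime p_gt2 (u1 n)).
apply: (cvgC_unique hC (continuous_cvg cL' hs s1 uZ un1 hu)).
apply: (@cvgC_near _ _ _ _ hC _ _ _ 0 _ (continuous_cvg cL hs s1 uZ un1 hu)) => n _.
have [[r prim] _] := twistP hC p_prime p_gt2 (u n) chi_dir.
(* [interpolates] is conditional on a solution B, so values at 1 - k are pinned down only once a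
   solution is exhibited. *)
have [|B hB] := gen_bernoulli_exists (fact_neq0 hC p_prime p_gt2) (f := p ^ r) (twist nrm p chi (u n)).
  by rewrite natrX (pX_neq0 hC).
by rewrite (iL _ _ _ (u1 n) prim hB) (iL' _ _ _ (u1 n) prim hB).
Qed.

Lemma Lp_numerator (F : C -> C) (K : R) : 0 <= K ->
  (forall s t, in_Zp s -> in_Zp t -> nrm (F s - F t) <= K * nrm (s - t)) ->
  (forall k, cvgC (volk k) (F (1 - k%:R))) ->
  forall s, in_Zp s -> s != 1 -> Lp nrm p chi s = F s / (s - 1).
Proof.
move=> K0 lip FV; apply: Lp_unique; first exact: continuous_div_sub1 lip.
move=> k f B k0 prim hB.
have k1 : k%:R != 0 :> C by exact: (natr_neq0 hC).
rewrite (cvgC_unique hC (FV k) (volkenborn_bernoulli hC p_prime p_gt2 chi_dir prim hB)).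
rewrite -[X in p%:R ^+ X / _](prednK k0) exprS; field.
by rewrite addrAC subrr add0r oppr_eq0 k1 (p_neq0 hC p_prime).
Qed.

End Interpolation.

(** * The formula with Euler factor at 2 *)

Section TwoRelation.
Local Open Scope classical_set_scope.
Local Open Scope ring_scope.
Context (R : realType) (p : nat) (C : fieldType) (nrm : C -> R)
  (hC : is_Cp p nrm) (p_prime : prime p) (p_gt2 : (2 < p)%N).
Local Notation q := (p%:R^-1 : R).
Local Notation cvgC := (cvgC nrm).
Local Notation in_Zp := (in_Zp nrm).
Local Notation omega := (omega nrm p).
Local Notation angle := (angle nrm p).
Local Notation padic_pow := (padic_pow nrm).

(** Used with y = p^n: the quadratic remainder still tends to 0 after division by p^n. *)
Lemma pow_taylor x y k : nrm x <= 1 -> nrm y <= 1 ->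
  nrm ((x + y) ^+ k.+1 - x ^+ k.+1 - k.+1%:R * y * x ^+ k) <= nrm y ^+ 2.
Proof.
move=> hx hy; elim: k => [|k IH].
  have -> : (x + y) ^+ 1 - x ^+ 1 - 1%:R * y * x ^+ 0 = 0 by ring.
  by rewrite (nrm0 hC) exprn_ge0 ?(nrm_ge0 hC).
set T := _ - _ - _ in IH.
have -> : (x + y) ^+ k.+2 - x ^+ k.+2 - k.+2%:R * y * x ^+ k.+1 =
  (x + y) * T + k.+1%:R * x ^+ k * y ^+ 2 by rewrite /T -!natr1 !exprS; ring.
apply: (nrmD_le hC); first by apply: (nrmM_le1l hC) => //; exact: (nrmD_le hC).
rewrite -(nrmX hC); apply: (nrmM_le1l hC) => //.
by apply: (nrmM_le1l hC); rewrite ?(nrm_nat hC) // (nrmX_le1 hC).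
Qed.

(** The even numbers below 2N are the even a < N and, because N is odd, the numbers a + N with a < N
    odd. *)
Lemma sum_even (G : nat -> C) N : odd N ->
  \sum_(0 <= a < N) G (2 * a)%N =
  \sum_(0 <= a < N) (if odd a then G (a + N)%N else G a).
Proof.
move=> oN; pose f x := if odd x then 0 else G x.
transitivity (\sum_(0 <= x < 2 * N) f x).
  rewrite sum_block; apply: eq_bigr => j _.
  by rewrite big_nat_recr //= big_nat1 /f add0n oddD !mul2n odd_double /= addr0.
rewrite mulnC sum_block big_nat_recr //= big_nat1 -big_split; apply: eq_bigr => a _ /=.
rewrite /f muln0 addn0 muln1 oddD oN addbT.
by case: ifP => /= _; rewrite ?add0r ?addr0.
Qed.

Context (chi : int -> C) (m : nat) (chi_dir : dirichlet_char (p ^ m) chi).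
Local Notation M := (maxn m 1).
Local Notation volk k := (volkenborn p (fun a : nat => chi a * angle a ^+ k)).
Local Notation summand s := (fun a : nat => chi a * (omega a)^-1 * padic_pow (angle a) (- s)).
Local Notation alt_sum s n := (\sum_(0 <= a < p ^ n) (-1) ^+ a / 2%:R * off_p p (summand s) a).

Lemma two_unit : ~~ (p %| 2)%N.
Proof. by apply/negP => /dvdn_leq; lia. Qed.

Lemma half_sign (a : nat) : (-1) ^+ a / 2%:R = 2%:R^-1 - (odd a)%:R :> C.
Proof.
have n2 : 2%:R != 0 :> C by exact: (natr_neq0 hC).
by rewrite -signr_odd; case: (odd a); rewrite /= ?expr0 ?expr1; field.
Qed.

Lemma two_relation k V l : cvgC (volk k.+1) V ->
  cvgC (fun n => alt_sum (1 - k.+1%:R) n) l ->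
  (1 - chi 2 * angle 2 ^+ k.+1) * V = k.+1%:R * l.
Proof.
move=> hV hl.
pose g a := off_p p (fun a : nat => chi a * omega a ^- k.+1) a.
have gnrm a : nrm (g a) <= 1.
  rewrite /g /off_p; case: ifPn => [_|pa]; first by rewrite (nrm0 hC).
  by rewrite (psi_nrm hC p_prime p_gt2 chi_dir).
have M0 n : (M <= n)%N -> (0 < n)%N by apply: leq_trans; exact: leq_maxr.
have gper n a j : (M <= n)%N -> g (a + p ^ n * j)%N = g a.
  move=> Mn; apply/eqP; rewrite -subr_eq0 off_pP ?M0 //; case: ifPn => // pa.
  by rewrite (psi_shift hC p_prime p_gt2 chi_dir) // subrr.
have g2 a : g (2 * a)%N = chi 2 * omega 2 ^- k.+1 * g a.
  rewrite /g /off_p Euclid_dvdM // (negPf two_unit) /=; case: ifPn => [_|pa]; first by rewrite mulr0.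
  case: chi_dir => _ mul _ _; rewrite PoszM mul.
  rewrite (omegaM hC p_prime p_gt2 (nat_p_int two_unit) (nat_p_int pa)) -[Posz 2]/(2 : int).
  by rewrite exprMn invfM; ring.
have volkE n : volk k.+1 n = p%:R ^- n * \sum_(0 <= a < p ^ n) g a * a%:R ^+ k.+1.
  congr (_ * _); apply: eq_bigr => a _; rewrite /g /off_p; case: ifPn => [_|pa]; first by rewrite mul0r.
  exact: (chi_angleX hC).
have altE n : alt_sum (1 - k.+1%:R) n = \sum_(0 <= a < p ^ n) (-1) ^+ a / 2%:R * (g a * a%:R ^+ k).
  apply: eq_bigr => a _; congr (_ * _); rewrite /g /off_p; case: ifPn => [_|pa]; first by rewrite mul0r.
  have -> : - (1 - k.+1%:R) = k%:R :> C by rewrite -natr1; ring.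
  rewrite (padic_pow_nat hC p_prime p_gt2); last exact: (angle_near1 hC p_prime p_gt2 (nat_p_int pa)).
  by rewrite /Defs.angle expr_div_n exprS invfM; ring.
(* By [half_sign] the indicator of odd a is 1/2 - (-1)^a / 2, so a sum over odd residues contains
   half of this full sum besides the alternating one. Not being divided by p^n, it is O(p^n). *)
have hT : cvgC (fun n => \sum_(0 <= a < p ^ n) g a * a%:R ^+ k) 0.
  pose D := (q ^+ M.+1)^-1.
  have D0 : 0 <= D by rewrite invr_ge0 (qX_ge0 R p_prime).
  apply: (cvgC_shiftn hC (M := M)).
  apply: (rate_cvg hC (r := fun n => D * q ^+ n) (rateZ D0 (rate_q R p_prime p_gt2))) => n.
  rewrite subr0; apply: (@le_trans _ _ (D * q ^+ (n + M))); last first.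
    by rewrite ler_wpM2l // (ler_qX R p_prime p_gt2) // leq_addr.
  apply: (lip_sum_bound hC (f := fun a => g a * a%:R ^+ k) (M := M)) => // [a|i a b Mi|]; last exact: leq_addl.
    apply: (@le_trans _ _ 1); first by apply: (nrmM_le1l hC) => //; rewrite (nrmX_le1 hC) // (nrm_nat hC).
    rewrite mulrC ler_pdivlMr ?(qX_gt0 R p_prime) // mul1r.
    exact: (ler_qX R p_prime p_gt2).
  rewrite gper // -mulrBr; apply: (nrmM_le1l hC) => //.
  apply: le_trans (exprn_lip hC _ _ _) _; rewrite ?(nrm_nat hC) //.
  rewrite natrD addrC addKr natrM natrX; apply: (nrmM_le1r hC); first exact: nrm_nat hC _.
  rewrite (nrm_pX hC) mulrC ler_pdivlMr ?(qX_gt0 R p_prime) // -exprD.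
  by apply: (ler_qX R p_prime p_gt2); rewrite addnS ltnS leq_addr.
pose c := chi 2 * angle 2 ^+ k.+1.
have cE : c = chi 2 * omega 2 ^- k.+1 * 2%:R ^+ k.+1.
  exact: (chi_angleX hC p_prime p_gt2 chi k.+1 two_unit).
(* The defect of the dilation identity at level n. It equals p^-n times a sum of Taylor remainders
   of size at most p^-2n, so it tends to 0, while its termwise limit is the claimed relation. *)
pose E n := (c - 1) * volk k.+1 n + k.+1%:R * alt_sum (1 - k.+1%:R) n
   - k.+1%:R / 2%:R * \sum_(0 <= a < p ^ n) g a * a%:R ^+ k.
have limE : cvgC E ((c - 1) * V + k.+1%:R * l - k.+1%:R / 2%:R * 0).
  by apply: (cvgCB hC); [apply: (cvgCD hC)|]; apply: (cvgCZ hC).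
have limE0 : cvgC E 0.
  apply: (cvgC_shiftn hC (M := M)).
  apply: (rate_cvg hC (rate_q R p_prime p_gt2)) => n; rewrite subr0.
  apply: (@le_trans _ _ (q ^+ (n + M))); last by rewrite (ler_qX R p_prime p_gt2) // leq_addr.
  have Mn := leq_addl n M; move: (n + M)%N Mn => {}n Mn.
  set P : C := p%:R ^+ n; have P0 : P != 0 by exact: (pX_neq0 hC).
  have nP : nrm P = q ^+ n by exact: (nrm_pX hC).
  have PE : P = (p ^ n)%:R by rewrite natrX.
  have -> : E n = P^-1 * \sum_(0 <= a < p ^ n) (if odd a then
     g a * ((a%:R + P) ^+ k.+1 - a%:R ^+ k.+1 - k.+1%:R * P * a%:R ^+ k) else 0).
    rewrite /E volkE altE -/P.
    (* Multiplication by c is the dilation a -> 2a. After [sum_even] the even residues cancel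
       against the original sum, and g does not see the shift by p^n. *)
    have -> : (c - 1) * (P^-1 * \sum_(0 <= a < p ^ n) g a * a%:R ^+ k.+1) =
       P^-1 * (\sum_(0 <= a < p ^ n) (if odd a then g a * ((a%:R + P) ^+ k.+1 - a%:R ^+ k.+1) else 0)).
      rewrite mulrCA; congr (_ * _); rewrite mulrBl mul1r cE mulr_sumr.
      under eq_bigr do rewrite mulrACA -g2 -exprMn -natrM.
      rewrite (sum_even (fun a => g a * a%:R ^+ k.+1)) ?oddX ?(odd_p p_prime p_gt2) ?orbT //.
      rewrite -sumrB; apply: eq_bigr => a _; case: ifP => _; last by rewrite subrr.
      by rewrite -{1}[(p ^ n)%N]muln1 gper // natrD -PE mulrBr.
    rewrite !mulr_sumr -big_split -sumrB; apply: eq_bigr => a _ /=.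
    rewrite half_sign; case: (odd a); rewrite ?mulr1n ?mulr0n; field; rewrite P0 (natr_neq0 hC) //.
  rewrite (nrmM hC) (nrmV hC) nP ler_pdivrMl ?(qX_gt0 R p_prime) // -expr2 -nP.
  apply: (nrm_sum hC) => [|a _]; first by rewrite exprn_ge0 // (nrm_ge0 hC).
  case: ifP => _; last by rewrite (nrm0 hC) exprn_ge0 // (nrm_ge0 hC).
  apply: (nrmM_le1l hC) => //; apply: pow_taylor; rewrite ?(nrm_nat hC) //.
  by rewrite PE (nrm_nat hC).
have := cvgC_unique hC limE limE0; rewrite mulr0 subr0 -/c => /eqP.
rewrite addr_eq0 => /eqP e; rewrite -[1 - c]opprB mulNr e opprK //.
Qed.

(** The Lipschitz constant is 1 because the weights have norm 1 and s -> <a>^(-s) is contracting,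
    both at every finite level. *)
Lemma alt_limit : exists N : C -> C,
  (forall s, in_Zp s -> cvgC (fun n => alt_sum s n) (N s)) /\
  forall s t, in_Zp s -> in_Zp t -> nrm (N s - N t) <= nrm (s - t).
Proof.
have ex s : exists l, in_Zp s -> cvgC (fun n => alt_sum s n) l.
  have [hs|ns] := pselect (in_Zp s); last by exists 0.
  have [|l hl] := alternating_cvg hC p_prime p_gt2 (f := off_p p (summand s)) (M := M); last by exists l.
  move=> n a j Mn; rewrite off_pP; last by apply: leq_trans Mn; exact: leq_maxr.
  case: ifPn => [_|pa]; first by rewrite (nrm0 hC) (qX_ge0 R p_prime).
  have := psi_shift hC p_prime p_gt2 chi_dir 1 j Mn pa; rewrite !expr1 => ->.
  have := psi_nrm hC p_prime p_gt2 chi_dir 1 pa; rewrite expr1 => h1.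
  rewrite -mulrBr (nrmM hC) h1 mul1r.
  have pa' := shift_unit j Mn pa.
  apply: le_trans (padic_pow_base_lip hC p_prime p_gt2 (angle_near1 hC p_prime p_gt2 (nat_p_int pa'))
    (angle_near1 hC p_prime p_gt2 (nat_p_int pa)) (in_ZpN hC hs)) _.
  exact: (angle_shift hC p_prime p_gt2 j Mn pa).
have [N hN] := choice ex; exists N; split=> // s t hs ht.
apply: (cvgC_nrm_le hC (cvgCB hC (hN s hs) (hN t ht))); exists 0%N => n _.
rewrite -sumrB; apply: (nrm_sum hC) => [|a _]; first exact: (nrm_ge0 hC).
rewrite -mulrBr !(nrmM hC) (nrm_sign hC) (nrm_half hC) // !mul1r /off_p.
case: ifPn => [_|pa]; first by rewrite subrr (nrm0 hC) (nrm_ge0 hC).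
have := psi_nrm hC p_prime p_gt2 chi_dir 1 pa; rewrite expr1 => h1.
have na := angle_near1 hC p_prime p_gt2 (nat_p_int pa).
rewrite -mulrBr (nrmM hC) h1 mul1r.
rewrite (padic_pow_lip hC p_prime p_gt2 na (in_ZpN hC hs) (in_ZpN hC ht)).
rewrite -opprD (nrmN hC) -[leRHS]mul1r ler_wpM2r ?(nrm_ge0 hC) //.
by apply: le_trans na _; apply: ltW; exact: q_lt1.
Qed.

Lemma angle2_near1 : nrm (angle 2 - 1) <= q.
Proof. exact: (angle_near1 hC p_prime p_gt2 (nat_p_int two_unit)). Qed.

Lemma Zp_1B s : in_Zp s -> in_Zp (- s + 1).
Proof. by move=> hs; apply: (in_ZpD hC) (in_ZpN hC hs) (in_Zp_nat hC 1). Qed.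

Lemma two_relation_Zp (F N : C -> C) (K : R) :
  (forall s t, in_Zp s -> in_Zp t -> nrm (F s - F t) <= K * nrm (s - t)) ->
  (forall k, cvgC (volk k) (F (1 - k%:R))) ->
  (forall s, in_Zp s -> cvgC (fun n => alt_sum s n) (N s)) ->
  (forall s t, in_Zp s -> in_Zp t -> nrm (N s - N t) <= nrm (s - t)) ->
  forall s, in_Zp s ->
    (1 - chi 2 * padic_pow (angle 2) (- s + 1)) * F s = (1 - s) * N s.
Proof.
move=> lipF FV NV lipN s hs.
have [u u1 hu] := in_Zp_cvg_1B hC p_prime p_gt2 1 hs.
have uZ n : in_Zp (1 - (u n)%:R) by apply/(in_ZpB hC)/in_Zp_nat/hC/(in_Zp_nat hC 1).
have cF : cvgC (fun n => F (1 - (u n)%:R)) (F s).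
  by apply: (cvgC_lip hC (K := K)) hu => n; exact: lipF.
have cN : cvgC (fun n => N (1 - (u n)%:R)) (N s).
  by apply: (cvgC_lip hC (K := 1)) hu => n; rewrite mul1r; exact: lipN.
have cP : cvgC (fun n => padic_pow (angle 2) (- (1 - (u n)%:R) + 1)) (padic_pow (angle 2) (- s + 1)).
  apply: (cvgC_lip hC (K := nrm (angle 2 - 1))) hu => n.
  rewrite (padic_pow_lip hC p_prime p_gt2 angle2_near1 (Zp_1B (uZ n)) (Zp_1B hs)).
  have -> : - (1 - (u n)%:R) + 1 - (- s + 1) = - (1 - (u n)%:R - s) :> C by ring.
  by rewrite (nrmN hC).
have c1 := cvgC_cst hC 1.
have lhs := cvgCM hC (cvgCB hC c1 (cvgCZ hC (chi 2) cP)) cF.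
have rhs := cvgCM hC (cvgCB hC c1 hu) cN.
apply: (cvgC_unique hC lhs); apply: (@cvgC_near _ _ _ _ hC _ _ _ 0 _ rhs) => n _ /=.
have -> : - (1 - (u n)%:R) + 1 = (u n)%:R :> C by ring.
have -> : 1 - (1 - (u n)%:R) = (u n)%:R :> C by ring.
rewrite (padic_pow_nat hC p_prime p_gt2 _ angle2_near1).
have := NV _ (uZ n); have := FV (u n); rewrite -(prednK (u1 n)) => h1 h2.
exact/esym/two_relation.
Qed.

Lemma denominator_neq0 s : in_Zp s -> s != 1 ->
  1 - chi 2 * padic_pow (angle 2) (- s + 1) != 0.
Proof.
move=> hs s1; apply/negP; rewrite subr_eq0 => /eqP e.
have hx := angle2_near1; have ht := Zp_1B hs.
(* The exponent [N0] makes chi(2) trivial; the further factor p - 1 is what [angle2_X_neq1]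
   needs. *)
pose N0 := totient (p ^ m); have N00 : (0 < N0)%N by rewrite totient_gt0 expn_gt0 prime_gt0.
have c1 : chi 2 ^+ (N0 * p.-1) = 1.
  rewrite exprM (dirichlet_root chi_dir) ?expr1n //.
  exact: (coprimez_pX p_prime _ (nat_p_int two_unit)).
have := congr1 (fun x => x ^+ (N0 * p.-1)) e.
rewrite expr1n exprMn c1 mul1r (padic_powX hC p_prime p_gt2 _ hx ht) => /esym h.
have := padic_pow_eq1 hC p_prime p_gt2 (expr_near1 hC p_prime p_gt2 (N0 * p.-1) hx) ht
  (angle2_X_neq1 hC p_prime p_gt2 N00) h.
by move/eqP; rewrite addrC subr_eq0 eq_sym (negPf s1).
Qed.

Lemma sum_mul_mod (g : nat -> C) N c : (0 < N)%N -> coprime c N ->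
  (forall a, g (a %% N)%N = g a) ->
  \sum_(0 <= a < N) g (c * a)%N = \sum_(0 <= a < N) g a.
Proof.
move=> N0 cop per; rewrite !big_mkord.
pose h (i : 'I_N) := Ordinal (ltn_pmod (c * i) N0).
have hinj : injective h.
  move=> i j /(congr1 val) /= /eqP e; apply: val_inj => /=.
  wlog ij : i j e / (i <= j)%N.
    by move=> H; case: (leqP i j) => [/H|/ltnW /H h']; [exact|apply/esym/h'; rewrite eq_sym].
  move: e; rewrite eq_sym eqn_mod_dvd ?leq_mul2l ?ij ?orbT // -mulnBr Gauss_dvdr; last by rewrite coprime_sym.
  move=> dv; have := ltn_ord j; case: (posnP (j - i)%N) => [|ji]; first by lia.
  by have := dvdn_leq ji dv; lia.
by rewrite [RHS](reindex_inj hinj); apply: eq_bigr => i _; rewrite /= per.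
Qed.

(** If chi were 1 at all naturals prime to p, it would be induced from the trivial character modulo
    1; primitivity then leaves only m = 0, where chi is constant. *)
Lemma nontrivial_unit : primitive_char (p ^ m) chi -> ~ (forall a, chi a = 1) ->
  exists2 b : nat, ~~ (p %| b)%N & chi b != 1.
Proof.
move=> [_ prim] nt; apply: contrapT => H.
have allu (b : int) : ~~ (p%:Z %| b)%Z -> chi b = 1.
  move=> pb; pose N := (p ^ M)%N.
  have N0 : N%:Z != 0 by rewrite eqz_nat -lt0n expn_gt0 prime_gt0.
  pose r := absz (b %% N%:Z)%Z.
  have rE : b - r%:Z = (b %/ N%:Z)%Z * N%:Z.
    by rewrite gez0_abs ?modz_ge0 // {1}(divz_eq b N%:Z) addrK.
  have pN : (p%:Z %| N%:Z)%Z by rewrite dvdzE /= dvdn_exp // leq_maxr.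
  have -> : chi b = chi r.
    by apply: (dirichlet_mod chi_dir); rewrite rE dvdz_mull // dvdzE /= dvdn_exp2l // leq_maxl.
  have pr : ~~ (p %| r)%N.
    move/negP: pb => pb; apply/negP => pr; apply: pb.
    by rewrite -(subrK r%:Z b) rE rpredD ?dvdz_mull // dvdzE.
  by apply: contrapT => /eqP c1; apply: H; exists r.
have tr1 : dirichlet_char 1 (fun=> 1 : C).
  by split=> // [a b|a]; rewrite ?mulr1 // coprimezE coprimen1 oner_neq0.
have := prim 1%N (fun=> 1) (dvd1n _) tr1.
have [m0|m0] := posnP m.
  move=> _; apply: nt => a; rewrite -(dirichlet1 chi_dir); apply: (dirichlet_mod chi_dir).
  by rewrite m0 expn0 dvd1z.
have h : forall a, coprimez a (p ^ m)%N%:Z -> chi a = 1.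
  move=> a cop; apply: allu; move: cop; rewrite coprimezE /= coprime_pexpr // => cop.
  by rewrite dvdzE -prime_coprime // coprime_sym.
by move=> /(_ h) e; have := ltn_exp2l 0 m (prime_gt1 p_prime); rewrite expn0 m0 {1}e ltnn.
Qed.

(** Orthogonality: multiplication by b permutes the residues and scales the sum by chi(b), which is
    not 1, so the sum is 0 for every n >= M. *)
Lemma volkenborn0_nontrivial : primitive_char (p ^ m) chi -> ~ (forall a, chi a = 1) ->
  cvgC (volk 0) 0.
Proof.
move=> prim nt; have [b pb cb] := nontrivial_unit prim nt.
apply: (@cvgC_near _ _ _ _ hC (fun=> 0) _ _ M); last exact: (cvgC_cst hC).
move=> n Mn; pose g := off_p p (fun a : nat => chi a * angle a ^+ 0).
have n0 : (0 < n)%N by apply: leq_trans Mn; exact: leq_maxr.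
rewrite /volkenborn -/g.
suff /eqP : chi b * \sum_(0 <= a < p ^ n) g a = \sum_(0 <= a < p ^ n) g a.
  rewrite -subr_eq0 -{2}[\sum_(_ <= _ < _) _]mul1r -mulrBl mulf_eq0 subr_eq0 (negPf cb) /=.
  by move=> /eqP; rewrite /g => ->; rewrite mulr0.
rewrite -[RHS](@sum_mul_mod g _ b) ?expn_gt0 ?prime_gt0 //; last 2 first.
- by rewrite coprime_sym coprimeXl // prime_coprime.
- move=> a; rewrite [in RHS](divn_eq a (p ^ n)) addnC mulnC; apply/esym/eqP.
  rewrite -subr_eq0 off_pP //; case: ifPn => // pa; rewrite !expr0 !mulr1.
  have := psi_shift hC p_prime p_gt2 chi_dir 0 (a %/ p ^ n) Mn pa.
  by rewrite !expr0 invr1 !mulr1 => ->; rewrite subrr.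
rewrite mulr_sumr; apply: eq_bigr => a _; rewrite /g /off_p Euclid_dvdM // (negPf pb) /=.
case: ifP => _; first by rewrite mulr0.
by case: chi_dir => _ mul _ _; rewrite !expr0 !mulr1 PoszM mul.
Qed.

Lemma volkenborn0_trivial : (forall a, chi a = 1) -> cvgC (volk 0) (p.-1%:R / p%:R).
Proof.
move=> tr; apply: (cvgC_shift_inv hC).
apply: (@cvgC_near _ _ _ _ hC (fun=> p.-1%:R / p%:R) _ _ 0); last exact: (cvgC_cst hC).
move=> n _; rewrite /volkenborn expnS sum_block.
have -> : \sum_(0 <= j < p ^ n) \sum_(0 <= a < p)
    off_p p (fun a : nat => chi a * angle a ^+ 0) (a + p * j)%N = p.-1%:R * p%:R ^+ n.
  rewrite (eq_bigr (fun=> p.-1%:R)) => [|j _].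
    by rewrite sumr_const_nat subn0 -natrX mulr_natr.
  rewrite big_ltn ?prime_gt0 // /off_p add0n dvdn_mulr // add0r.
  rewrite big_nat_cond (eq_bigr (fun=> 1)) => [|a /andP[/andP[a1 ap] _]].
    by rewrite -big_nat_cond sumr_const_nat subn1.
  by rewrite dvdn_addl ?dvdn_mulr // gtnNdvd // tr expr0 mulr1.
by rewrite exprS; field; rewrite (pX_neq0 hC) // (p_neq0 hC).
Qed.

End TwoRelation.

Section Main.
Context (R : realType) (p : nat) (C : fieldType) (nrm : C -> R)
  (hC : is_Cp p nrm) (p_prime : prime p) (p_gt2 : (2 < p)%N).

Lemma Lp_formula (chi : int -> C) (m : nat) : primitive_char (p ^ m) chi ->
  (forall s : C, in_Zp nrm s -> s != 1 ->
     1 - chi 2 * padic_pow nrm (angle nrm p 2) (- s + 1) != 0 /\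
     exists l : C,
       cvgC nrm
         (fun n => \sum_(1 <= a < (p ^ n).+1 | ~~ (p %| a)%N)
            (-1) ^+ a / 2%:R * twist nrm p chi 1 a%:Z
              * padic_pow nrm (angle nrm p a%:Z) (- s)) l /\
       Lp nrm p chi s =
         -1 / (1 - chi 2 * padic_pow nrm (angle nrm p 2) (- s + 1)) * l) /\
  (~ (forall a, chi a = 1) -> extends_analytically nrm (Lp nrm p chi)) /\
  ((forall a, chi a = 1) -> analytic_but_simple_pole_at1 nrm (Lp nrm p chi)).
Proof.
move=> prim; have chi_dir := prim.1.
have [F [anF [K [K0 lipF]] FV F1]] := numerator_exists hC p_prime p_gt2 chi_dir.
have LF := Lp_numerator hC p_prime p_gt2 chi_dir K0 lipF FV.
have [N [hN lipN]] := alt_limit hC p_prime p_gt2 chi_dir.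
have rel := two_relation_Zp hC p_prime p_gt2 chi_dir lipF FV hN lipN.
have F1E : F (1 - 0%:R) = F 1 by rewrite subr0.
split=> [s hs s1|]; last split=> [nt|tr].
- have den := denominator_neq0 hC p_prime p_gt2 chi_dir hs s1.
  split=> //; exists (N s); split.
    (* The two index ranges agree from n = 1 on only: for n = 0 the sum over 1 <= a <= p^n contains
       the unit a = 1. *)
    apply: (@cvgC_near _ _ _ _ hC _ _ _ 1 _ (hN s hs)) => n n1.
    rewrite (sum_off_p p_prime) //; apply: eq_bigr => a _; rewrite /off_p.
    case: ifPn => [_|pa]; first by rewrite mulr0.
    have [_ agree] := twistP hC p_prime p_gt2 1 chi_dir.
    by rewrite (agree _ (nat_p_int pa)) expr1 mulrA.
  have s10 : s - 1 != 0 by rewrite subr_eq0.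
  (* The minus sign of the formula is (1 - s) / (s - 1). *)
  rewrite LF // -[F s](mulKf den) rel //.
  by field; rewrite s10 den.
- have F10 : F 1 = 0.
    by rewrite -F1E; apply: (cvgC_unique hC (FV 0%N)); exact: (volkenborn0_nontrivial hC p_prime p_gt2 chi_dir prim nt).
  have [G anG FG] := F1 F10; exists G; split=> // s hs s1.
  have s10 : s - 1 != 0 by rewrite subr_eq0.
  by rewrite LF // FG // mulrAC mulfV ?mul1r.
- exists F; split=> //; rewrite -F1E.
  rewrite (cvgC_unique hC (FV 0%N) (volkenborn0_trivial hC p_prime tr)).
  by rewrite mulf_neq0 ?invr_eq0 ?(p_neq0 hC p_prime) // (natr_neq0 hC p_prime p_gt2) // p1_gt0.
Qed.

End Main.

Theorem corollary3p1 (R : realType) (p : nat) (C : fieldType) (nrm : C -> R)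
  (hC : is_Cp p nrm) (p_prime : prime p) (p_gt2 : (2 < p)%N) :
  (forall (chi : int -> C) (m : nat), primitive_char (p ^ m) chi ->
     (forall s : C, in_Zp nrm s -> s != 1 ->
        1 - chi 2 * padic_pow nrm (angle nrm p 2) (- s + 1) != 0 /\
        exists l : C,
          cvgC nrm
            (fun n => \sum_(1 <= a < (p ^ n).+1 | ~~ (p %| a)%N)
               (-1) ^+ a / 2%:R * twist nrm p chi 1 a%:Z
                 * padic_pow nrm (angle nrm p a%:Z) (- s)) l /\
          Lp nrm p chi s =
            -1 / (1 - chi 2 * padic_pow nrm (angle nrm p 2) (- s + 1)) * l) /\
     (~ (forall a, chi a = 1) -> extends_analytically nrm (Lp nrm p chi)) /\
     ((forall a, chi a = 1) ->
        analytic_but_simple_pole_at1 nrm (Lp nrm p chi))) /\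
  (forall i : nat, (i < p.-1)%N ->
     forall s : C, in_Zp nrm s -> s != 1 ->
       1 - omega nrm p 2 ^ (1 - i%:Z)
             * padic_pow nrm (angle nrm p 2) (- s + 1) != 0 /\
       exists l : C,
         cvgC nrm
           (fun n => \sum_(1 <= a < (p ^ n).+1 | ~~ (p %| a)%N)
              (-1) ^+ a / 2%:R * omega nrm p a%:Z ^- i
                * padic_pow nrm (angle nrm p a%:Z) (- s)) l /\
         zeta_branch nrm p i s =
           -1 / (1 - omega nrm p 2 ^ (1 - i%:Z)
                       * padic_pow nrm (angle nrm p 2) (- s + 1)) * l).
Proof.
split=> [chi m|i _ s hs s1]; first exact: Lp_formula.
have [[r prim] agree] := omega_powP hC p_prime p_gt2 (1 - i%:Z).
have [/(_ s hs s1)[den [l [hl e]]] _] := Lp_formula hC p_prime p_gt2 prim.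
have e2 := agree 2 (nat_p_int (two_unit p_prime p_gt2)).
rewrite /zeta_branch; rewrite !e2 in den e; split=> //; exists l; split=> //.
apply: (cvgC_near hC (M := 0) _ hl) => n _; apply: eq_bigr => a pa.
(* For chi = omega^(1-i) the twist by omega^-1 leaves omega^-i. The chosen primitive characters are
   specified off p only, which suffices for these summands and for the argument 2. *)
have [_ ->] := twistP hC p_prime p_gt2 1 prim.1; last exact: nat_p_int.
have w0 := omega_neq0 hC p_prime p_gt2 (nat_p_int pa).
rewrite (agree _ (nat_p_int pa)); congr (_ * _ * _).
by rewrite expfzDr // expr1z expr1 mulrAC mulfV // mul1r exprnN.
Qed.
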